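(* Let $\mathsf{M}$ be a loopless and coloopless Schubert matroid on $[n]$ (with respect to the order $1<2<\dots<n$), with set of bases $\mathscr{B}$. Then \[ g_{\mathsf{M}}(t)=t\sum_{\substack{B\in\mathscr{B}\\ e(B)=1,\ i(B)=0}}(t+1)^{\alpha(B)}.\]
   Context: Schubert matroid: for an $r$-subset $U\subseteq[n]$, order $r$-subsets by $\{i_1<\dots<i_r\}\le\{j_1<\dots<j_r\}$ iff $i_\ell\le j_\ell$ for all $\ell$; the Schubert matroid with defining set $U$ has as bases the $r$-subsets $B$ of $[n]$ with $U\le B$. Activities with respect to the order $1<\dots<n$: an element $b\in B$ is internally active if $b$ is the smallest element of the unique cocircuit contained in $([n]\smallsetminus B)\cup\{b\}$; an element $x\notin B$ is externally active if $x$ is the smallest element of the unique circuit contained in $B\cup\{x\}$; $i(B)$ and $e(B)$ are the numbers of internally and externally active elements. For a basis $B$, $\alpha(B)$ is the number of $i\in B$ such that $B'=(B\smallsetminus\{i\})\cup\{i+1\}$ is a basis with $e(B')=e(B)$ and $i(B')=i(B)$. The $g$-polynomial: $\mathsf{M}\mapsto g_{\mathsf{M}}(t)\in\mathbb{Z}[t]$ is the unique isomorphism invariant of matroids such that (i) $g_{\mathsf{M}}=0$ if $\mathsf{M}$ has loops or coloops; (ii) $g_{\mathsf{M}}=t$ if $\mathsf{M}$ is series-parallel on at least two elements; (iii) $g_{\mathsf{M}_1\oplus\mathsf{M}_2}=g_{\mathsf{M}_1}g_{\mathsf{M}_2}$; (iv) it is a covaluation: whenever the base polytope $\mathscr{P}(\mathsf{M})$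 is subdivided into base polytopes of matroids, $g_{\mathsf{M}}$ equals the sum of $g_{\mathsf{N}}$ over the matroids $\mathsf{N}$ whose polytopes are the internal faces of the subdivision. *)

(* Defs.v *)
From HB Require Import structures.
From mathcomp Require Import all_boot all_order all_algebra.
From mathcomp Require Import boolp classical_sets reals.

Set Implicit Arguments.
Unset Strict Implicit.
Unset Printing Implicit Defensive.

Import Order.TTheory GRing.Theory Num.Theory.

Local Open Scope ring_scope.
Local Open Scope nat_scope.

Definition basis_axioms (T : finType) (Bs : {set {set T}}) : bool :=
  (Bs != finset.set0) &&
  [forall A in Bs, forall B in Bs, forall x in A :\: B,
     exists y in B :\: A, (y |: (A :\ x)) \in Bs].

(* The ground set of a [matroid T] is all of the finite type [T]. *)
Record matroid (T : finType) := Matroid {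
  bases : {set {set T}};
  basesP : basis_axioms bases }.

HB.instance Definition _ (T : finType) := [isSub for @bases T].
HB.instance Definition _ (T : finType) := [Finite of matroid T by <:].

Section BasicNotions.
Variable T : finType.
Implicit Types (M : matroid T) (Bs : {set {set T}}).

Definition circuits_of Bs : {set {set T}} :=
  [set C | minset [pred X : {set T} | ~~ [exists B in Bs, X \subset B]] C].

Definition circuits M := circuits_of (bases M).

(* The bases of the dual matroid are the complements of the bases. *)
Definition cocircuits M := circuits_of [set ~: B | B in bases M].

Definition loopless M := [forall x, exists B in bases M, x \in B].
Definition coloopless M := [forall x, exists B in bases M, x \notin B].

End BasicNotions.

Definition matroid_iso (T1 T2 : finType) (M1 : matroid T1) (M2 : matroid T2) :=
  exists2 f : T1 -> T2, bijective f &
    forall B : {set T1}, (f @: B \in bases M2) = (B \in bases M1).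

Definition is_direct_sum (T1 T2 : finType)
    (M1 : matroid T1) (M2 : matroid T2) (M : matroid (T1 + T2)%type) :=
  bases M = [set (inl @: (B1 : {set T1})) :|: (inr @: (B2 : {set T2}))
              | B1 in bases M1, B2 in bases M2]%SET.

(* [N] is the deletion [M \ e]. This description of its bases is correct
   because [e], being in a circuit, is not a coloop. *)
Definition parallel_extension (T : finType) (M : matroid T) (e f : T)
    (N : matroid {x : T | x != e}) :=
  [/\ e != f, [set e; f]%SET \in circuits M &
      bases N = [set B : {set {x : T | x != e}} | (val @: B) \in bases M]%SET].

(* [N] is the contraction [M / e]. This description of its bases is correct
   because [e], being in a cocircuit, is not a loop. *)
Definition series_extension (T : finType) (M : matroid T) (e f : T)
    (N : matroid {x : T | x != e}) :=
  [/\ e != f, [set e; f]%SET \in cocircuits M &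
      bases N =
        [set B : {set {x : T | x != e}} | (e |: (val @: B)) \in bases M]%SET].

(* Series-parallel matroids are connected: since the two elements of a
   2-circuit (2-cocircuit) are not loops (coloops), a loop is never extended in
   parallel, nor a coloop in series. *)
Inductive series_parallel : forall T : finType, matroid T -> Prop :=
| SP_single (T : finType) (M : matroid T) : #|T| = 1 -> series_parallel M
| SP_parallel (T : finType) (M : matroid T) (e f : T)
    (N : matroid {x : T | x != e}) :
    parallel_extension M f N -> series_parallel N -> series_parallel M
| SP_series (T : finType) (M : matroid T) (e f : T)
    (N : matroid {x : T | x != e}) :
    series_extension M f N -> series_parallel N -> series_parallel M.

Section Polytopes.
Local Open Scope ring_scope.
Local Open Scope classical_set_scope.
Variables (R : realType) (T : finType).
Implicit Types (M N : matroid T) (P F : set (T -> R)).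

Definition base_polytope M : set (T -> R) :=
  [set x : T -> R | exists w : {set T} -> R,
     [/\ forall B, 0 <= w B,
         \sum_(B in bases M) w B = 1 &
         forall i, x i = \sum_(B in bases M) w B * (i \in B)%:R]].

(* Nonempty faces: sets of maximisers of linear functionals ([c = 0] gives the
   face [P] itself). *)
Definition is_face P F := exists c : T -> R,
  F = [set x | P x /\
         forall y, P y -> \sum_(i : T) c i * y i <= \sum_(i : T) c i * x i].

(* The relative boundary of a polytope, as the union of its proper faces. *)
Definition boundary P : set (T -> R) :=
  [set x | exists F, [/\ is_face P F, F <> P & F x]].

(* [S] consists of all the nonempty cells, of every dimension, of a polyhedral
   complex with support the base polytope of [M]. *)
Definition is_subdivision M (S : {set matroid T}) :=
  [/\ base_polytope M = [set x | exists2 N, N \in S & base_polytope N x],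
      forall N F, N \in S -> is_face (base_polytope N) F ->
        exists2 N', N' \in S & base_polytope N' = F &
      forall N1 N2, N1 \in S -> N2 \in S ->
        let F := base_polytope N1 `&` base_polytope N2 in
        F = set0 \/
        (is_face (base_polytope N1) F /\ is_face (base_polytope N2) F)].

Definition internal_face M N :=
  ~ (base_polytope N `<=` boundary (base_polytope M)).

End Polytopes.

Section GPolynomial.
Local Open Scope ring_scope.

Record is_g_polynomial (R : realType)
    (g : forall T : finType, matroid T -> {poly int}) : Prop := {
  g_iso : forall (T1 T2 : finType) (M1 : matroid T1) (M2 : matroid T2),
    matroid_iso M1 M2 -> g T1 M1 = g T2 M2;
  g_loop_coloop : forall (T : finType) (M : matroid T),
    ~~ (loopless M && coloopless M) -> g T M = 0;
  g_series_parallel : forall (T : finType) (M : matroid T),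
    (2 <= #|T|)%N -> series_parallel M -> g T M = 'X;
  g_direct_sum : forall (T1 T2 : finType) (M1 : matroid T1) (M2 : matroid T2)
      (M : matroid (T1 + T2)%type),
    is_direct_sum M1 M2 M -> g (T1 + T2)%type M = g T1 M1 * g T2 M2;
  g_covaluation : forall (T : finType) (M : matroid T) (S : {set matroid T}),
    is_subdivision R M S ->
    g T M = \sum_(N in S | `[< internal_face R M N >]) g T N }.

End GPolynomial.

(* The set [n] = {1, ..., n} is represented by ['I_n], shifted by one. *)
Section OrderedMatroids.
Variable n : nat.
Implicit Types (M : matroid 'I_n) (U B C : {set 'I_n}).

(* [enum] lists a subset of ['I_n] in increasing order, and [all2] requires
   lists of the same size. *)
Definition gale_le U B := all2 (fun i j : 'I_n => i <= j) (enum U) (enum B).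

Definition is_schubert M U := bases M = [set B | gale_le U B]%SET.

Definition is_smallest (x : 'I_n) C :=
  (x \in C) && [forall y in C, x <= y].

Definition internally_active M B (b : 'I_n) :=
  (b \in B) &&
  [exists C in cocircuits M, (C \subset b |: ~: B) && is_smallest b C].

Definition externally_active M B (x : 'I_n) :=
  (x \notin B) &&
  [exists C in circuits M, (C \subset x |: B) && is_smallest x C].

Definition int_activity M B := #|[pred b | internally_active M B b]|.
Definition ext_activity M B := #|[pred x | externally_active M B x]|.

Definition alpha M B :=
  #|[pred i : 'I_n | (i \in B) &&
      [exists j : 'I_n, (j == i.+1 :> nat) &&
        let B' := j |: (B :\ i) in
        [&& B' \in bases M, ext_activity M B' == ext_activity M B
          & int_activity M B' == int_activity M B]]]|.

End OrderedMatroids.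

(* Main.v *)
(* Identify a set [B] with the lattice path [j |-> height B j = #|B :&: [0, j)|]. A
   Schubert matroid is then a lattice path matroid: its bases are the paths in the
   region below the path [height U]. The hyperplane through an interior lattice
   point of such a region cuts the base polytope into the polytopes of two smaller
   lattice path matroids, whose common facet is the polytope of a direct sum, and
   these three are the only internal faces; so [g] satisfies a three-term
   recursion. When no interior point is left the region is a border strip and the
   matroid is series-parallel. Cutting always at the upper right corner of the last
   cell of an initial strip, [g] becomes ['X] times the sum over Delannoy paths of
   unit cells of ['X] to the number of diagonal steps. Opening each diagonal step
   into a north step followed by an east step, this is a sum over paths without
   diagonals, weighted by ['X + 1] to the number of north-east corners. These
   paths are the bases [B] with [e(B) = 1] and [i(B) = 0], i.e. with [0] not in [B],
   [1] in [B] and [height B b < height U b] for all [b] in [B], and their corners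
   are counted by [alpha]. *)

Require Import Defs.
From mathcomp Require Import boolp classical_sets.
From mathcomp Require Import all_boot all_order all_algebra.
From mathcomp Require Import reals zify ring lra.

Set Implicit Arguments.
Unset Strict Implicit.
Unset Printing Implicit Defensive.

Import Order.TTheory GRing.Theory Num.Theory.

Local Open Scope nat_scope.
Local Open Scope set_scope.

(** * Basis exchange *)

(** The covaluation axiom speaks of a whole polyhedral complex, so a cut is usable only once three
    things are known. Every face of a base polytope is itself a base polytope. The two halves of a
    cut are base polytopes: a polytope given by integer bounds on prefix sums is the hull of its 0/1
    points, so cutting one prefix sum at an integer only changes one bound. No further cell is
    internal: a functional maximal on a cell of one half is already maximal on the whole polytope,
    or becomes so after subtracting a multiple of the cutting functional.

    The choice of the corner makes the recursion close: the left summand of the common facet is a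
    strip, worth ['X], and the right summand starts again from a single cell. Of the resulting two
    factors ['X] one belongs to the global prefactor, the other is the weight of a diagonal step.
    Looplessness and colooplessness make the top path start with a north step and end with an east
    step, which puts the first cell at position 1 and height 0. *)

Section BasisExchange.
Variables (T : finType) (Bs : {set {set T}}).
Hypothesis BsP : basis_axioms Bs.
Implicit Types (A B C D : {set T}) (x y : T).

Lemma basis_exists : exists B, B \in Bs.
Proof. by case/andP: BsP => /set0Pn. Qed.

Lemma basis_exchange A B x : A \in Bs -> B \in Bs -> x \in A -> x \notin B ->
  exists y, [/\ y \in B, y \notin A & y |: (A :\ x) \in Bs].
Proof.
move=> AB BB xA xB; case/andP: BsP => _ /forallP/(_ A)/implyP/(_ AB).
move=> /forallP/(_ B)/implyP/(_ BB)/forallP/(_ x)/implyP.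
rewrite inE xA xB => /(_ isT)/existsP[y /andP[]].
by rewrite inE => /andP[yA yB] ?; exists y.
Qed.

Definition fund_circuit B x := x |: [set b in B | x |: (B :\ b) \in Bs].

(** Take a basis over the set with as few elements outside [x |: B] as possible. An element outside
    could be exchanged for one of [B], giving a better choice; with none outside, exchanging a
    missing [b] from [B] can only bring in [x], which puts [b] in the set. *)
Lemma fund_circuit_dependent B D x : B \in Bs -> x \notin B -> D \in Bs ->
  ~~ (fund_circuit B x \subset D).
Proof.
move=> BB xB DB; apply/negP => CD.
pose p := [pred D | (D \in Bs) && (fund_circuit B x \subset D)].
have pD : p D by rewrite /= DB.
case: (@arg_minnP _ D p (fun D => #|D :\: (x |: B)|) pD) => E /andP[EB CE] minE.
have [EB'|/subsetPn[d dE]] := boolP (E \subset x |: B).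
  have [b bB bE] : exists2 b, b \in B & b \notin E.
    apply/subsetPn; apply/negP => BE.
    have xE : x \in E by apply: (subsetP CE); rewrite !inE eqxx.
    have [y [yB yE _]] := basis_exchange EB BB xE xB.
    by rewrite (subsetP BE) in yE.
  have [x' [xE' xB' Eb']] := basis_exchange BB EB bB bE.
  have x'E : x' = x.
    by move: (subsetP EB' _ xE'); rewrite !inE (negbTE xB') orbF => /eqP.
  case/negP: bE; apply: (subsetP CE).
  by rewrite !inE bB -x'E Eb' orbT.
rewrite !inE negb_or => /andP[dx dB].
have [y [yB yE Ey]] := basis_exchange EB BB dE dB.
have /minE : p (y |: (E :\ d)).
  rewrite /= Ey /=; apply/subsetP => z zC; rewrite !inE (subsetP CE) // andbT.
  apply/orP; right; apply: contraTneq zC => ->.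
  by rewrite !inE negb_or dx (negbTE dB).
rewrite leqNgt => /negP[]; apply: proper_card; apply/properP; split.
  apply/subsetP => z; rewrite !inE.
  case: (eqVneq z y) => [->|_]; first by rewrite yB orbT.
  by case: (z == d); rewrite /= ?andbF.
exists d; rewrite !inE negb_or dx dB ?dE ?eqxx //= orbF.
by apply: contraTneq yB => <-.
Qed.

(** Minimality: a subset without [x] lies in [B], and one without an exchangeable [b] lies in the
    basis [x |: (B :\ b)]. *)
Lemma fund_circuitP B x : B \in Bs -> x \notin B ->
  fund_circuit B x \in circuits_of Bs.
Proof.
move=> BB xB; rewrite inE; apply/minsetP; split=> [|X /= Xdep XC].
  apply/negP => /existsP[D /andP[DB CD]].
  by move: (fund_circuit_dependent BB xB DB); rewrite CD.
have indep D : D \in Bs -> ~~ (X \subset D).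
  by move=> DB; apply: contra Xdep => XD; apply/existsP; exists D; rewrite DB.
apply/eqP; rewrite eqEsubset XC; apply/subsetP => b.
rewrite !inE => /orP[/eqP->|/andP[bB Bb]]; apply/negPn/negP => bX.
  case/negP: (indep B BB); apply/subsetP => z zX.
  move: (subsetP XC _ zX); rewrite !inE => /orP[/eqP zx|/andP[]//].
  by rewrite -zx zX in bX.
case/negP: (indep _ Bb); apply/subsetP => z zX.
move: (subsetP XC _ zX); rewrite !inE => /orP[->//|/andP[-> _]].
by rewrite (contraNneq _ bX) ?orbT // => <-.
Qed.

(* Let [D] be a basis containing the fundamental circuit of [x] in [B] minus [x]
   and meeting [A] in as many elements as possible. It avoids [x], and its elements
   outside [A] lie on that circuit; so exchanging [x] from [A] into [D] lands on
   the circuit. *)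
Lemma symmetric_exchange A B x :
    A \in Bs -> B \in Bs -> x \in A -> x \notin B ->
  exists y, [/\ y \in B, y \notin A,
    y |: (A :\ x) \in Bs & x |: (B :\ y) \in Bs].
Proof.
move=> AB BB xA xB; pose Y := fund_circuit B x :\ x.
have YB : Y \subset B.
  apply/subsetP => z; rewrite !inE; case: (z == x) => //=.
  by move=> /andP[].
pose p := [pred D | (D \in Bs) && (Y \subset D)].
have pB : p B by rewrite /= BB.
case: (@arg_maxnP _ B p (fun D => #|D :&: A|) pB) => D /andP[DB YD] maxD.
have xD : x \notin D.
  apply/negP => xD; move/negP: (fund_circuit_dependent BB xB DB); apply.
  apply/subsetP => z zC; have [->//|zx] := eqVneq z x.
  by apply: (subsetP YD); rewrite inE zC andbT inE.
have DAY z : z \in D -> z \notin A -> z \in Y.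
  move=> zD zA; apply/negPn/negP => zY.
  have [a [aA aD Da]] := basis_exchange DB AB zD zA.
  have /maxD : p (a |: (D :\ z)).
    rewrite /= Da /=; apply/subsetP => w wY; rewrite 2!inE.
    rewrite in_setD1 (subsetP YD) // andbT.
    by rewrite (contraTneq _ wY) ?orbT // => ->.
  rewrite /= leqNgt => /negP[]; apply: proper_card; apply/properP; split.
    apply/subsetP => w; rewrite !inE => /andP[wD wA]; rewrite wA wD andbT.
    by rewrite (contraTneq _ wA) ?orbT // => ->.
  by exists a; rewrite !inE ?eqxx ?aA // (negbTE aD).
have [y [yD yA Ay]] := basis_exchange AB DB xA xD.
have := DAY y yD yA; rewrite !inE => /andP[/negbTE->] /= /andP[yB By].
by exists y.
Qed.

(** A swap in a complement prescribes the element that enters the original basis; this is what the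
    second half of the symmetric exchange supplies. *)
Lemma dual_basis_axioms : basis_axioms [set ~: B | B in Bs].
Proof.
have [B0 B0B] := basis_exists.
apply/andP; split; first by apply/set0Pn; exists (~: B0); apply: imset_f.
apply/forallP => A'; apply/implyP => /imsetP[A AB ->].
apply/forallP => B'; apply/implyP => /imsetP[B BB ->].
apply/forallP => x; apply/implyP; rewrite !inE negbK => /andP[xB xA].
have [y [yA yB _ Ay]] := symmetric_exchange BB AB xB xA.
apply/existsP; exists y; rewrite !inE yA yB /=; apply/imsetP.
exists (x |: (A :\ y)) => //; apply/setP => z; rewrite !inE negb_or negb_and negbK.
have [->|_] := eqVneq z y; last by [].
by rewrite ?andbT ?orTb; symmetry; apply: contraNneq xA => <-.
Qed.

End BasisExchange.

(** A circuit inside [x |: B] contains every exchangeable [b], since otherwise it would lie in the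
    basis [x |: (B :\ b)]. The family [Bs] is arbitrary so that the dual is covered too. *)
Lemma active_in_fund_circuit n (Bs : {set {set 'I_n}}) (B : {set 'I_n}) x :
    basis_axioms Bs -> B \in Bs -> x \notin B ->
  [exists C in circuits_of Bs, (C \subset x |: B) && is_smallest x C] =
  [forall b in B, (x |: (B :\ b) \in Bs) ==> (x < b)].
Proof.
move=> BsP BB xB; apply/existsP/forallP => [[C /and3P[CC CB Cx]] b|act].
  apply/implyP => bB; apply/implyP => Bb.
  have bC : b \in C.
    apply/negPn/negP => bC; move: CC; rewrite inE => /minsetp/= /negP[].
    apply/existsP; exists (x |: (B :\ b)); rewrite Bb /=.
    apply/subsetP => z zC; move: (subsetP CB _ zC); rewrite !inE.
    by rewrite (contraTneq _ zC) // => ->.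
  case/andP: Cx => _ /forallP/(_ b)/implyP/(_ bC).
  by rewrite leq_eqVlt => /orP[/eqP/val_inj xb|//]; rewrite xb bB in xB.
exists (fund_circuit Bs B x); rewrite fund_circuitP //=; apply/andP; split.
  by apply/subsetP => z; rewrite !inE => /orP[->//|/andP[->]]; rewrite orbT.
apply/andP; split; first by rewrite !inE eqxx.
apply/forallP => b; apply/implyP; rewrite !inE => /orP[/eqP->//|/andP[bB Bb]].
by move: (act b); rewrite bB Bb => /ltnW.
Qed.

(** * Faces of base polytopes *)

Section PolytopeFaces.
Local Open Scope ring_scope.
Variables (R : realType) (T : finType).
Implicit Types (M N : matroid T) (A B : {set T}) (x y z c a : T -> R)
  (Q F G : set (T -> R)).
Local Notation P := (@base_polytope R T).

Definition vertex B : T -> R := fun i => (i \in B)%:R.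
Definition lin c x : R := \sum_i c i * x i.
Definition weight c B : R := \sum_(i in B) c i.
Definition argmax (Q : set (T -> R)) c : set (T -> R) :=
  [set x | Q x /\ forall y, Q y -> lin c y <= lin c x]%classic.

Lemma lin_scaleDl k c1 c2 x :
  lin (fun i => k * c1 i + c2 i) x = k * lin c1 x + lin c2 x.
Proof.
rewrite /lin mulr_sumr -big_split /=.
by apply: eq_bigr => i _; rewrite mulrDl mulrA.
Qed.

Lemma lin_combr c k1 k2 x y :
  lin c (fun i => k1 * x i + k2 * y i) = k1 * lin c x + k2 * lin c y.
Proof.
rewrite /lin !mulr_sumr -big_split /=.
by apply: eq_bigr => i _; rewrite mulrDr !mulrA ![c i * _]mulrC.
Qed.

Lemma lin0 x : lin (fun=> 0) x = 0.
Proof. by rewrite /lin big1 // => i _; rewrite mul0r. Qed.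

Lemma lin_vertex c B : lin c (vertex B) = weight c B.
Proof.
rewrite /lin /weight [RHS]big_mkcond /=; apply: eq_bigr => i _.
by rewrite /vertex; case: (i \in B); rewrite ?mulr1 ?mulr0.
Qed.

Lemma weight_swap c B u v : u \in B -> v \notin B ->
  weight c (v |: (B :\ u)) = weight c B - c u + c v.
Proof.
move=> uB vB; rewrite /weight big_setU1 ?inE ?(negbTE vB) ?andbF //=.
by rewrite [\sum_(i in B) c i](big_setD1 u uB) /=; ring.
Qed.

Lemma lin_comb (Bs : {set {set T}}) (w : {set T} -> R) c x :
  (forall i, x i = \sum_(B in Bs) w B * (i \in B)%:R) ->
  lin c x = \sum_(B in Bs) w B * weight c B.
Proof.
move=> xE; rewrite /lin.
under eq_bigr => i _ do rewrite xE mulr_sumr.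
rewrite exchange_big /=; apply: eq_bigr => B _.
rewrite -lin_vertex /lin mulr_sumr; apply: eq_bigr => i _.
by rewrite /vertex; ring.
Qed.

Lemma sum_subset (As Bs : {set {set T}}) (F : {set T} -> R) :
    As \subset Bs -> (forall B, B \in Bs -> B \notin As -> F B = 0) ->
  \sum_(B in As) F B = \sum_(B in Bs) F B.
Proof.
move=> sAB F0; rewrite [RHS](big_setID As) /= (setIidPr sAB).
by rewrite [X in _ + X]big1 ?addr0 // => B; rewrite inE => /andP[? ?]; apply: F0.
Qed.

Lemma vertex_polytope M B : B \in bases M -> P M (vertex B).
Proof.
move=> BM; exists (fun A => (A == B)%:R); split.
- by move=> A; rewrite ler0n.
- by rewrite (bigD1 B) //= eqxx big1 ?addr0 // => A /andP[_ /negbTE->].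
- move=> i; rewrite (bigD1 B) //= eqxx mul1r big1 ?addr0 //.
  by move=> A /andP[_ /negbTE->]; rewrite mul0r.
Qed.

(** A 0/1 point is extreme in the cube: any basis of positive weight in a combination agrees with
    [B] in every coordinate. *)
Lemma vertex_polytopeP M B : P M (vertex B) <-> B \in bases M.
Proof.
split; last exact: vertex_polytope.
move=> [w [w0 w1 wE]].
have [A AM wA] : exists2 A, A \in bases M & 0 < w A.
  have : \sum_(A in bases M) w A != 0 by rewrite w1 oner_neq0.
  case: (pselect (exists2 A, A \in bases M & 0 < w A)) => // nex.
  rewrite big1 ?eqxx // => A AM; apply/eqP; rewrite eq_le w0 andbT leNgt.
  by apply/negP => wA; apply: nex; exists A.
suff <- : A = B by [].
apply/setP => i; have := wE i; rewrite /vertex.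
case iB: (i \in B); case iA: (i \in A) => // iE.
  have S0 : \sum_(C in bases M) w C * (i \notin C)%:R = 0.
    have iE1 : 1 = \sum_(C in bases M) w C * (i \in C)%:R := iE.
    rewrite -[RHS](subrr 1) [X in _ = _ - X]iE1 -[X in _ = X - _]w1 -sumrB; apply: eq_bigr => C _.
    by case: (i \in C); rewrite ?mulr1 ?mulr0 ?subrr ?subr0.
  have : w A * (i \notin A)%:R = 0.
    by apply: psumr_eq0P S0 _ AM => C _; rewrite mulr_ge0.
  by rewrite iA mulr1 => wA0; rewrite wA0 ltxx in wA.
have : w A * (i \in A)%:R = 0.
  by apply: psumr_eq0P (esym iE) _ AM => C _; rewrite mulr_ge0.
by rewrite iA mulr1 => wA0; rewrite wA0 ltxx in wA.
Qed.

Lemma base_polytope_inj M N : P M = P N -> M = N.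
Proof.
move=> PE; apply: val_inj; apply/setP => B /=.
by apply/idP/idP => /vertex_polytopeP H; apply/vertex_polytopeP;
   rewrite ?PE // -PE.
Qed.

Lemma lin_polytope_le c M m x :
  (forall B, B \in bases M -> weight c B <= m) -> P M x -> lin c x <= m.
Proof.
move=> le_m [w [w0 w1 wE]]; rewrite (lin_comb c wE) -[m]mul1r -w1 mulr_suml.
by apply: ler_sum => B BM; rewrite ler_wpM2l // le_m.
Qed.

Lemma polytope_convex M x y k : P M x -> P M y -> 0 <= k <= 1 ->
  P M (fun i => (1 - k) * x i + k * y i).
Proof.
move=> [v [v0 v1 vE]] [w [w0 w1 wE]] /andP[k0 k1].
exists (fun B => (1 - k) * v B + k * w B); split.
- by move=> B; rewrite addr_ge0 // mulr_ge0 // subr_ge0.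
- by rewrite big_split /= -!mulr_sumr v1 w1; ring.
- move=> i; rewrite vE wE !mulr_sumr -big_split /=; apply: eq_bigr => B _.
  by ring.
Qed.

Lemma argmax_matroid M c : exists N m,
  [/\ forall B, B \in bases M -> weight c B <= m,
      bases N = [set B in bases M | weight c B == m] &
      P N = argmax (P M) c].
Proof.
have [B0 B0M] := basis_exists (basesP M).
case: (@Order.TotalTheory.arg_maxP _ _ _ B0 [pred B | B \in bases M]
  (weight c) B0M) => Bm /= BmM maxBm; pose m := weight c Bm.
have le_m B : B \in bases M -> weight c B <= m by exact: maxBm.
pose Bs := [set B in bases M | weight c B == m].
have BsP : basis_axioms Bs.
  apply/andP; split; first by apply/set0Pn; exists Bm; rewrite inE BmM eqxx.
  apply/forallP => A; apply/implyP; rewrite inE => /andP[AM /eqP Am].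
  apply/forallP => B; apply/implyP; rewrite inE => /andP[BM /eqP Bm'].
  apply/forallP => x; apply/implyP; rewrite inE => /andP[xB xA].
  have [y [yB yA Ay By]] := symmetric_exchange (basesP M) AM BM xA xB.
  apply/existsP; exists y; rewrite !inE yA yB Ay /=.
  have := le_m _ Ay; have := le_m _ By; rewrite !weight_swap // Am Bm' => ? ?.
  by apply/eqP; lra.
exists (Matroid BsP), m; split=> //.
have sBs : Bs \subset bases M by apply/subsetP => B; rewrite inE => /andP[].
apply/seteqP; split=> x.
  move=> [w [w0 w1 wE]].
  have lx : lin c x = m.
    rewrite (lin_comb c wE) -[RHS]mul1r -w1 mulr_suml; apply: eq_bigr => B.
    by rewrite inE => /andP[_ /eqP->].
  split; last by move=> y Py; rewrite lx; apply: lin_polytope_le Py.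
  exists (fun B => if B \in Bs then w B else 0); split.
  - by move=> B; case: ifP.
  - rewrite -(sum_subset sBs) => [|B _ /negbTE->//].
    by rewrite -[RHS]w1; apply: eq_bigr => B /= ->.
  - move=> i; rewrite -(sum_subset sBs) => [|B _ /negbTE->]; last by rewrite mul0r.
    by rewrite wE; apply: eq_bigr => B /= ->.
move=> [[w [w0 w1 wE]] maxx].
have := maxx _ (vertex_polytope BmM); rewrite lin_vertex (lin_comb c wE) => mx.
have S0 : \sum_(B in bases M) w B * (m - weight c B) = 0.
  apply/eqP; rewrite eq_le; apply/andP; split; last first.
    by apply: sumr_ge0 => B BM; rewrite mulr_ge0 // subr_ge0 le_m.
  under eq_bigr => B _ do rewrite mulrBr.
  by rewrite sumrB -mulr_suml w1 mul1r subr_le0.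
have wB0 B : B \in bases M -> B \notin Bs -> w B = 0.
  move=> BM; rewrite inE BM /= => Bm'.
  have /eqP : w B * (m - weight c B) = 0.
    by apply: psumr_eq0P S0 _ BM => C CM; rewrite mulr_ge0 // subr_ge0 le_m.
  by rewrite mulf_eq0 subr_eq0 [m == _]eq_sym (negbTE Bm') orbF => /eqP.
exists w; split=> //.
  by rewrite (sum_subset sBs).
by move=> i; rewrite (sum_subset sBs) // => B BM /wB0 ->//; rewrite mul0r.
Qed.

Lemma face_matroid M F : is_face (P M) F -> exists N, P N = F.
Proof.
by move=> [c ->]; have [N [m [_ _ NE]]] := argmax_matroid M c; exists N.
Qed.

Lemma is_face_refl Q : is_face Q Q.
Proof.
exists (fun=> 0); apply/seteqP; split=> x; last by case.
by move=> Qx; split=> // y _; rewrite -/(lin _ _) -/(lin _ x) !lin0.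
Qed.

(** Lexicographic maximisation: [K * c1 + c2] with [K] large selects the maximisers of [c1] first,
    then those of [c2] among them. *)
Lemma face_face M F G : is_face (P M) F -> is_face F G -> is_face (P M) G.
Proof.
move=> [c1 FE] [c2 ->].
have [N [m1 [le1 NE]]] := argmax_matroid M c1.
rewrite -[argmax _ _]FE => <-.
have [N2 [m2 [le2 N2E PN2]]] := argmax_matroid N c2.
rewrite -/(argmax _ _) -PN2.
(* The absolute value of the [K] at which [B] would tie; bases already maximal for [c1] give 0
   through division by zero. The sum of all gaps plus 1 exceeds each of them strictly. *)
pose gap B : R := `|(weight c2 B - m2) / (m1 - weight c1 B)|.
pose K : R := \sum_(B in bases M) gap B + 1.
have dom B : B \in bases M -> weight c1 B < m1 ->
    weight c2 B - m2 < K * (m1 - weight c1 B).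
  move=> BM lt1; rewrite -ltr_pdivrMr ?subr_gt0 //.
  apply: le_lt_trans (ler_norm _) _; rewrite /K (bigD1 B) //=.
  rewrite -[`|_|]addr0 -addrA ltrD2l ltr_wpDl //.
  by apply: sumr_ge0 => C _; rewrite normr_ge0.
pose c i : R := K * c1 i + c2 i.
have wc B : weight c B = K * weight c1 B + weight c2 B.
  by rewrite -!lin_vertex lin_scaleDl.
have [N3 [m3 [le3 N3E PN3]]] := argmax_matroid M c.
exists c; rewrite -/(argmax _ _) -PN3; congr (P _).
suff: bases N2 = bases N3 by exact: val_inj.
have [B2 B2N2] := basis_exists (basesP N2).
have /and3P[B2M /eqP B21 /eqP B22] :
    [&& B2 \in bases M, weight c1 B2 == m1 & weight c2 B2 == m2].
  by move: B2N2; rewrite N2E inE NE inE -andbA.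
have leB B : B \in bases M ->
    weight c B <= K * m1 + m2 ?= iff (B \in bases N2).
  move=> BM; rewrite wc N2E inE NE inE BM /=.
  have [eq1|ne1] := eqVneq (weight c1 B) m1.
    rewrite eq1 /=; have := le2 B; rewrite NE inE BM eq1 eqxx => /(_ isT) le2B.
    by split; [lra | rewrite (inj_eq (addrI _))].
  have lt1 : weight c1 B < m1 by rewrite lt_neqAle ne1 le1.
  have := dom B BM lt1; rewrite mulrBr => ?; split; first by lra.
  by apply/negbTE; rewrite neq_lt; apply/orP; left; lra.
have m3E : m3 = K * m1 + m2.
  apply/eqP; rewrite eq_le; apply/andP; split.
    have [B3] := basis_exists (basesP N3); rewrite N3E inE => /andP[B3M /eqP<-].
    exact: (leB _ B3M).1.
  by apply: le_trans (le3 _ B2M); rewrite wc B21 B22.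
apply/setP => B; rewrite N3E inE m3E.
case BM: (B \in bases M); last first.
  by rewrite N2E inE NE inE BM.
by have [_ eqB] := leB B BM; rewrite eqB.
Qed.

(** The common point [z] guarantees that the maximum of the second functional over [Q] is attained
    on [F]; otherwise it could select a different face of [F]. *)
Lemma inter_faces Q F G z : is_face Q F -> is_face Q G ->
  F z -> G z -> is_face F (F `&` G)%classic.
Proof.
move=> [c1 ->] [c2 ->] [Qz z1] [_ z2]; exists c2.
apply/seteqP; split=> x.
  by move=> [[Qx x1] [_ x2]]; split=> // y [Qy _]; apply: x2.
move=> [[Qx x1] x2]; split=> //; split=> // y Qy.
by apply: le_trans (z2 y Qy) (x2 z _).
Qed.

End PolytopeFaces.

(** * Hyperplane splits *)

Section HyperplaneSplit.
Local Open Scope ring_scope.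
Variables (R : realType) (T : finType).
Implicit Types (M N : matroid T) (A B C : {set T}) (x y z c a : T -> R) (h : R).
Local Notation P := (@base_polytope R T).

Lemma linN a x : lin (fun i => - a i) x = - lin a x.
Proof. by rewrite /lin -sumrN; apply: eq_bigr => i _; rewrite mulNr. Qed.

Lemma weightN a B : weight (fun i => - a i) B = - weight a B.
Proof. by rewrite -!lin_vertex linN. Qed.

(** A Lagrange multiplier for the constraint [lin a x = h]: the largest ratio over the bases above
    the hyperplane, attained at [D]. A basis below is joined to [D]; the segment meets the
    hyperplane, where [c] is at most [v]. *)
Lemma exists_multiplier M a c h v B :
    (forall x, P M x -> lin a x = h -> lin c x <= v) ->
    B \in bases M -> h < weight a B ->
  exists mu, forall C, C \in bases M -> weight c C - v <= mu * (weight a C - h).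
Proof.
move=> le_v BM hB.
pose ratio C := (weight c C - v) / (weight a C - h).
have pB : [pred C | (C \in bases M) && (h < weight a C)] B by rewrite /= BM.
case: (@Order.TotalTheory.arg_maxP _ _ _ B _ ratio pB) => D /= /andP[DM hD] maxD.
exists (ratio D) => C CM; have [Ch|hC|Ch] := ltgtP (weight a C) h; last first.
- rewrite Ch subrr mulr0 subr_le0 -lin_vertex le_v ?lin_vertex //.
  exact: vertex_polytope.
- rewrite -ler_pdivrMr ?subr_gt0 //; apply: maxD; exact/andP.
pose k := (h - weight a C) / (weight a D - weight a C).
have d0 : 0 < weight a D - weight a C by rewrite subr_gt0 (lt_trans Ch).
have kE : k * (weight a D - weight a C) = h - weight a C.
  by rewrite /k divfK ?gt_eqF.
have k01 : 0 <= k <= 1.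
  apply/andP; split; first by rewrite divr_ge0 // ltW // subr_gt0.
  by rewrite ler_pdivrMr // mul1r lerD2r ltW.
have /le_v := polytope_convex (vertex_polytope R CM) (vertex_polytope R DM) k01.
rewrite !lin_combr !lin_vertex.
have -> : (1 - k) * weight a C + k * weight a D = h.
  by rewrite -[RHS](subrK (weight a C)) -kE; ring.
move=> /(_ erefl) lev.
rewrite /ratio mulrAC ler_pdivlMr ?subr_gt0 //.
have : (weight a D - weight a C) * ((1 - k) * weight c C + k * weight c D)
    <= (weight a D - weight a C) * v by rewrite ler_pM2l.
have -> : (weight a D - weight a C) * ((1 - k) * weight c C + k * weight c D) =
  (weight a D - weight a C) * weight c C +
  (k * (weight a D - weight a C)) * (weight c D - weight c C) by ring.
by rewrite kE; move=> ?; nra.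
Qed.

(** If the cell has a point strictly below the hyperplane, the functional defining it is maximal on
    all of [P M] by convexity. If the cell lies in the hyperplane, the functional is tilted by a
    multiple of [a]. The resulting face of [P M] is proper: were it everything, the cell would be
    [M1], respectively [M12]. *)
Lemma half_face M M1 M12 N a h B :
    P M1 = [set x | P M x /\ lin a x <= h]%classic ->
    P M12 = [set x | P M x /\ lin a x = h]%classic ->
    B \in bases M -> h < weight a B ->
    is_face (P M1) (P N) -> N <> M1 -> N <> M12 ->
  (P N `<=` boundary (P M))%classic.
Proof.
move=> P1 P12 BM hB [c]; rewrite -/(argmax _ _) => NE NM1 NM12.
have [B0 /(vertex_polytope R)] := basis_exists (basesP N).
set z0 := vertex R B0; move=> Nz0.
have NM1' x : P N x -> P M1 x by rewrite NE => -[].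
have PM1 x : P M1 x -> P M x by rewrite P1 => -[].
have [[z [Nz za]]|nz] := pselect (exists z, P N z /\ lin a z < h).
  have zmax y : P M y -> lin c y <= lin c z.
    move=> My; move: (Nz); rewrite NE => -[M1z z_max].
    have [yh|yh] := leP (lin a y) h; first by apply: z_max; rewrite P1.
    (* A point [y] beyond the hyperplane is pulled back towards [z] to where the segment crosses;
       [k] is positive, so the comparison there decides the one at [y]. *)
    pose k := (h - lin a z) / (lin a y - lin a z).
    have d0 : 0 < lin a y - lin a z by rewrite subr_gt0 (lt_trans za).
    have kE : k * (lin a y - lin a z) = h - lin a z by rewrite divfK ?gt_eqF.
    have k0 : 0 < k by rewrite divr_gt0 // subr_gt0.
    have k1 : k <= 1 by rewrite ler_pdivrMr // mul1r lerD2r ltW.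
    have k01 : 0 <= k <= 1 by rewrite k1 (ltW k0).
    have := z_max (fun i => (1 - k) * z i + k * y i).
    rewrite P1 /= !lin_combr => le.
    have : (1 - k) * lin c z + k * lin c y <= lin c z.
      apply: le; split; first by apply: polytope_convex => //; apply: PM1.
      have -> : (1 - k) * lin a z + k * lin a y =
        k * (lin a y - lin a z) + lin a z by ring.
      by rewrite kE subrK.
    move=> le'; rewrite -(ler_pM2l k0); lra.
  have [FM|FM] := pselect (argmax (P M) c = P M).
    case: NM1; apply: (@base_polytope_inj R); apply/seteqP; split=> [//|x M1x].
    rewrite NE; split=> // y M1y.
    have : P M x by apply: PM1.
    by rewrite -FM => -[_]; apply; apply: PM1.
  move=> x Nx; exists (argmax (P M) c); split=> //; first by exists c.
  split; first by apply/PM1/NM1'.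
  move=> y My; apply: le_trans (zmax y My) _.
  by move: Nx; rewrite NE => -[_]; apply; apply: NM1'.
have Na x : P N x -> lin a x = h.
  move=> Nx; apply/eqP; rewrite eq_le; apply/andP; split.
    by have := NM1' _ Nx; rewrite P1 => -[].
  by rewrite leNgt; apply/negP => lt; apply: nz; exists x.
have Nc x y : P N x -> P M1 y -> lin c y <= lin c x.
  by rewrite NE => -[_]; apply.
have [|mu le_mu] := @exists_multiplier M a c h (lin c z0) B _ BM hB.
  by move=> x Mx xh; apply: Nc; rewrite // P1; split; rewrite ?xh.
pose c' i : R := - mu * a i + c i.
have c'E x : lin c' x = - mu * lin a x + lin c x by rewrite lin_scaleDl.
have c'le y : P M y -> lin c' y <= - mu * h + lin c z0.
  apply: lin_polytope_le => C CM; have := le_mu C CM.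
  rewrite -(lin_vertex c') c'E !lin_vertex; lra.
have c'N x : P N x -> lin c' x = - mu * h + lin c z0.
  move=> Nx; rewrite c'E (Na _ Nx); congr (_ + _).
  by apply/eqP; rewrite eq_le !Nc // ; apply: NM1'.
have [FM|FM] := pselect (argmax (P M) c' = P M).
  case: NM12; apply: (@base_polytope_inj R); apply/seteqP; split=> x.
    by move=> Nx; rewrite P12; split; [apply/PM1/NM1' | apply: Na].
  rewrite P12 => -[Mx xh]; rewrite NE; split.
    by rewrite P1; split; rewrite ?xh.
  move=> y M1y; apply: le_trans (Nc _ _ Nz0 M1y) _.
  move: Mx; rewrite -FM => -[_] /(_ _ (PM1 _ (NM1' _ Nz0))).
  by rewrite (c'N _ Nz0) -/(lin _ _) c'E xh lerD2l.
move=> x Nx; exists (argmax (P M) c'); split=> //; first by exists c'.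
by split; [apply/PM1/NM1' | move=> y My; rewrite (c'N _ Nx) c'le].
Qed.

(** A functional attaining its maximum at a point where every basis has positive weight is constant
    on the bases, so the face it defines is everything. *)
Lemma positive_weights_interior M x (w : {set T} -> R) :
    (forall B, B \in bases M -> 0 < w B) -> \sum_(B in bases M) w B = 1 ->
    (forall i, x i = \sum_(B in bases M) w B * (i \in B)%:R) ->
  ~ boundary (P M) x.
Proof.
move=> w0 w1 wE [F [[c FE] FM]]; rewrite FE => -[Mx xmax].
have wc B : B \in bases M -> weight c B = lin c x.
  have S0 : \sum_(B in bases M) w B * (lin c x - weight c B) = 0.
    under eq_bigr => C _ do rewrite mulrBr.
    by rewrite sumrB -mulr_suml w1 mul1r (lin_comb c wE) subrr.
  move=> BM; have /eqP : w B * (lin c x - weight c B) = 0.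
    apply: psumr_eq0P S0 _ BM => C CM; apply: mulr_ge0; first exact/ltW/w0.
    by rewrite subr_ge0 -lin_vertex; apply: xmax; apply: vertex_polytope.
  by rewrite mulf_eq0 gt_eqF ?w0 //= subr_eq0 => /eqP.
apply: FM; rewrite FE; apply/seteqP; split=> [y []//|y My]; split=> // z Mz.
rewrite -/(lin c y) -/(lin c z); apply: (@le_trans _ _ (lin c x)).
  by apply: lin_polytope_le Mz => B /wc->.
suff : - lin c y <= - lin c x by rewrite lerN2.
by rewrite -linN; apply: lin_polytope_le My => B /wc; rewrite weightN => ->.
Qed.

(** Start at the barycentre of all bases and move towards [A] or [B] until the hyperplane is met;
    this happens before the end, so all weights stay positive. *)
Lemma exists_interior_point M a h A B : A \in bases M -> B \in bases M ->
    weight a A < h -> h < weight a B ->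
  exists x, [/\ P M x, lin a x = h & ~ boundary (P M) x].
Proof.
move=> AM BM Ah hB.
pose w0 : R := #|bases M|%:R^-1.
have M0 : (0 < #|bases M|)%N by apply/card_gt0P; exists A.
have w0_gt0 : 0 < w0 by rewrite invr_gt0 ltr0n.
pose b : R := w0 * \sum_(C in bases M) weight a C.
have [D [DM k0 k1 kE]] : exists D, [/\ D \in bases M,
    0 <= (h - b) / (weight a D - b), (h - b) / (weight a D - b) < 1 &
    (h - b) / (weight a D - b) * (weight a D - b) = h - b].
  have [bh|hb] := leP b h.
    have d0 : 0 < weight a B - b by rewrite subr_gt0 (le_lt_trans bh).
    exists B; rewrite divfK ?gt_eqF // divr_ge0 ?subr_ge0 ?(ltW d0) //.
      by rewrite ltr_pdivrMr // mul1r ltrD2r.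
    by rewrite -subr_ge0 ltW.
  have d0 : 0 < b - weight a A by rewrite subr_gt0 (lt_trans Ah).
  exists A; rewrite -[_ - b]opprB -[weight a A - b]opprB invrN mulrNN.
  rewrite mulrN divfK ?gt_eqF // divr_ge0 ?subr_ge0 ?(ltW hb) ?(ltW d0) //.
    by rewrite ltr_pdivrMr // mul1r ltrD2l ltrN2.
  by rewrite -subr_ge0 ltW.
set k := (h - b) / _ in k0 k1 kE.
pose w C : R := (1 - k) * w0 + k * (C == D)%:R.
have w_gt0 C : 0 < w C.
  apply: ltr_wpDr; first by rewrite mulr_ge0.
  by rewrite mulr_gt0 // subr_gt0.
have w1 : \sum_(C in bases M) w C = 1.
  rewrite big_split /= -!mulr_sumr sumr_const -[w0 *+ _]mulr_natl divff ?pnatr_eq0 -?lt0n //.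
  rewrite (bigD1 D) //= eqxx big1 => [|C /andP[_ /negbTE->]//].
  by rewrite !mulr1 addr0 mulr1 subrK.
exists (fun i => \sum_(C in bases M) w C * (i \in C)%:R); split.
- by exists w; split=> // C; apply: ltW.
- rewrite (lin_comb (Bs := bases M) (w := w)) //.
  have wE C : w C * weight a C =
      (1 - k) * (w0 * weight a C) + k * ((C == D)%:R * weight a C).
    by rewrite /w; ring.
  rewrite (eq_bigr _ (fun C _ => wE C)) big_split /= -!mulr_sumr -/b (bigD1 D) //= eqxx mul1r.
  rewrite [X in k * (_ + X)]big1 => [|C /andP[_ /negbTE->]]; last by rewrite mul0r.
  have -> : (1 - k) * b + k * (weight a D + 0) = k * (weight a D - b) + b by ring.
  by rewrite kE subrK.
- exact: (@positive_weights_interior M _ w).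
Qed.

Section Split.
Variables (M M1 M2 M12 : matroid T) (a : T -> R) (h : R) (A B : {set T}).
Hypotheses (P1 : P M1 = [set x | P M x /\ lin a x <= h]%classic)
  (P2 : P M2 = [set x | P M x /\ h <= lin a x]%classic)
  (P12 : P M12 = [set x | P M x /\ lin a x = h]%classic)
  (AM : A \in bases M) (BM : B \in bases M)
  (Ah : weight a A < h) (hB : h < weight a B).

Definition split_cells : {set matroid T} :=
  [set N | `[< is_face (P M1) (P N) \/ is_face (P M2) (P N) >]].

Lemma split_cellsP N : N \in split_cells <->
  is_face (P M1) (P N) \/ is_face (P M2) (P N).
Proof. by rewrite inE; split=> [/asboolP|?] //; apply/asboolP. Qed.

Let P12_1 : is_face (P M1) (P M12).
Proof.
have [x [Mx xh _]] := exists_interior_point AM BM Ah hB.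
exists a; rewrite P1 P12; apply/seteqP; split=> y /=.
  by move=> [My yh]; split; [split; rewrite ?yh | move=> z [_ zh]; rewrite -/(lin a y) yh].
move=> [[My yh] ymax]; split=> //; apply/eqP; rewrite eq_le yh -xh.
by apply: ymax; split; rewrite ?xh.
Qed.

Let P12_2 : is_face (P M2) (P M12).
Proof.
have [x [Mx xh _]] := exists_interior_point AM BM Ah hB.
exists (fun i => - a i); rewrite P2 P12; apply/seteqP; split=> y /=.
  move=> [My yh]; split; [by split; rewrite ?yh | move=> z [_ zh]].
  by rewrite -/(lin _ y) -/(lin _ z) !linN yh lerN2.
move=> [[My yh] ymax]; split=> //; apply/eqP; rewrite eq_le yh andbT -xh.
by rewrite -lerN2 -!linN; apply: ymax; split; rewrite ?xh.
Qed.

(** [F] meets [G] inside the cut, and the part of [G] in [P M12] is a face of [P M12], hence of the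
    first half; so two faces of one polytope are intersected. *)
Lemma cross_faces M1' M2' F G :
    is_face (P M1') (P M12) -> is_face (P M2') (P M12) ->
    (forall x, P M1' x -> P M2' x -> P M12 x) ->
    is_face (P M1') F -> is_face (P M2') G ->
    (F `&` G)%classic = classical_sets.set0 \/ is_face F (F `&` G)%classic.
Proof.
move=> f1 f2 int12 fF fG.
have [E|/eqP/classical_sets.set0P[z [Fz Gz]]] := pselect ((F `&` G)%classic = classical_sets.set0).
  by left.
have subF x : F x -> P M1' x by case: fF => c -> [].
have subG x : G x -> P M2' x by case: fG => c -> [].
have z12 : P M12 z by apply: int12; [apply: subF | apply: subG].
right; have G12 : is_face (P M1') (P M12 `&` G)%classic.
  exact: face_face f1 (inter_faces f2 fG z12 Gz).
have -> : (F `&` G = F `&` (P M12 `&` G))%classic.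
  apply/seteqP; split=> x [Fx]; last by case.
  by move=> Gx; split=> //; split=> //; apply: int12; [apply: subF|apply: subG].
by apply: (inter_faces fF G12 Fz).
Qed.

Let int12 x : P M1 x -> P M2 x -> P M12 x.
Proof.
rewrite P1 P2 P12 => -[Mx le1] [_ le2]; split=> //.
by apply/eqP; rewrite eq_le le1.
Qed.

Lemma split_subdivision : is_subdivision R M split_cells.
Proof.
have S1 : M1 \in split_cells by apply/split_cellsP; left; apply: is_face_refl.
have S2 : M2 \in split_cells by apply/split_cellsP; right; apply: is_face_refl.
split.
- apply/seteqP; split=> x.
    move=> Mx; have [xh|/ltW xh] := leP (lin a x) h.
      by exists M1; rewrite // P1.
    by exists M2; rewrite // P2.
  move=> [N /split_cellsP[[c ->]|[c ->]]] []; first by rewrite P1 => -[].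
  by rewrite P2 => -[].
- move=> N F /split_cellsP fN fF; have [N' N'E] := face_matroid fF.
  exists N' => //; apply/split_cellsP; rewrite N'E.
  by case: fN => fN; [left|right]; apply: face_face fN fF.
- move=> N1 N2 /split_cellsP f1 /split_cellsP f2 F.
  have [E|/eqP/classical_sets.set0P[z [z1 z2]]] := pselect (F = classical_sets.set0); first by left.
  right; suff both (N N' : matroid T) :
      (is_face (P M1) (P N) \/ is_face (P M2) (P N)) ->
      (is_face (P M1) (P N') \/ is_face (P M2) (P N')) ->
      P N z -> P N' z -> is_face (P N) (P N `&` P N')%classic.
    by split; [|rewrite /F classical_sets.setIC]; apply: both.
  move=> fN fN' Nz N'z.
  have nE : (P N `&` P N')%classic <> classical_sets.set0.
    by move=> E; have : (P N `&` P N')%classic z by []; rewrite E.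
  case: fN => fN; case: fN' => fN'.
  + exact: inter_faces fN fN' Nz N'z.
  + by case: (cross_faces P12_1 P12_2 int12 fN fN').
  + have int21 x : P M2 x -> P M1 x -> P M12 x by move=> *; apply: int12.
    by case: (cross_faces P12_2 P12_1 int21 fN fN').
  + exact: inter_faces fN fN' Nz N'z.
Qed.

Lemma split_internal N : N \in split_cells ->
  internal_face R M N <-> N \in [set M1; M2; M12].
Proof.
move=> /split_cellsP fN; have [x [Mx xh xbd]] := exists_interior_point AM BM Ah hB.
split=> [int|]; last first.
  rewrite !inE -orbA => /or3P[] /eqP-> sub; apply: xbd; apply: sub.
  - by rewrite P1 /= xh.
  - by rewrite P2 /= xh.
  - by rewrite P12.
apply/negPn/negP; rewrite !inE !negb_or => /andP[/andP[/eqP n1 /eqP n2] /eqP n12].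
apply: int; case: fN => fN; first exact: half_face P1 P12 BM hB fN n1 n12.
(* The upper half is the lower half for the opposite functional, with [A] now on the far side. *)
apply: (@half_face M M2 M12 N (fun i => - a i) (- h) A) => //.
- rewrite P2; apply/seteqP; split=> y /=; rewrite linN => -[My yh]; split=> //.
    by rewrite lerN2.
  by rewrite -lerN2.
- rewrite P12; apply/seteqP; split=> y /=; rewrite linN => -[My yh]; split=> //.
    by rewrite yh.
  by apply: oppr_inj.
- by rewrite weightN ltrN2.
Qed.

(** [A] and [B] lie strictly on opposite sides, which makes the three internal cells pairwise
    distinct, so the sum has three separate terms. *)
Lemma covaluation_split (g : forall T : finType, matroid T -> {poly int}) :
  is_g_polynomial R g -> g T M = g T M1 + g T M2 + g T M12.
Proof.
move=> hg; rewrite (g_covaluation hg split_subdivision).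
have A1 : A \in bases M1.
  apply/(vertex_polytopeP R); rewrite P1 /= lin_vertex; split; last exact: ltW.
  exact: vertex_polytope.
have A2 : A \notin bases M2.
  by apply/negP => /(vertex_polytopeP R); rewrite P2 /= lin_vertex leNgt Ah => -[].
have A12 : A \notin bases M12.
  by apply/negP => /(vertex_polytopeP R); rewrite P12 /= lin_vertex => -[_ E];
     move: Ah; rewrite E ltxx.
have B2 : B \in bases M2.
  apply/(vertex_polytopeP R); rewrite P2 /= lin_vertex; split; last exact: ltW.
  exact: vertex_polytope.
have B12 : B \notin bases M12.
  by apply/negP => /(vertex_polytopeP R); rewrite P12 /= lin_vertex => -[_ E];
     move: hB; rewrite E ltxx.
have n12 : M1 != M2 by apply: contraTneq A1 => ->.
have n13 : M1 != M12 by apply: contraTneq A1 => ->.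
have n23 : M2 != M12 by apply: contraTneq B2 => ->.
rewrite (eq_bigl (mem [set M1; M2; M12])) => [|N].
  rewrite -setUA big_setU1 ?inE ?negb_or ?n12 //= big_setU1 ?inE //= big_set1.
  by rewrite addrA.
rewrite [RHS]/=; case NS: (N \in split_cells) => /=.
  by apply/asboolP/idP => /(split_internal NS).
symmetry; apply/negbTE; apply/negP; rewrite !inE -orbA => N3.
move/negP: NS; apply; apply/split_cellsP.
case/or3P: N3 => /eqP->; [left|right|by left].
  exact: is_face_refl.
exact: is_face_refl.
Qed.

End Split.
End HyperplaneSplit.

(** * Lattice path matroids *)

Section Heights.
Variable n : nat.
Implicit Types (A B : {set 'I_n}) (j k : nat).

(** Indexed by [nat] and false from [n] on, so that heights are defined everywhere and constant from
    [n] on. *)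
Definition nmem B j : bool := if insub j is Some i then i \in B else false.
Definition height B j : nat := \sum_(i < j) nmem B i.

Lemma nmemE B (i : 'I_n) : nmem B i = (i \in B).
Proof. by rewrite /nmem (valK i). Qed.

Lemma nmem_lt B j : nmem B j -> j < n.
Proof. by rewrite /nmem; case: insubP. Qed.

Lemma nmem_ex B j : nmem B j -> exists2 i : 'I_n, i \in B & i = j :> nat.
Proof. by rewrite /nmem; case: insubP => // i _ <- iB; exists i. Qed.

Lemma heightE0 B : height B 0 = 0.
Proof. by rewrite /height big_ord0. Qed.

Lemma heightS B j : height B j.+1 = height B j + nmem B j.
Proof. by rewrite /height big_ord_recr. Qed.

Lemma height_card B : height B n = #|B|.
Proof.
rewrite /height -sum1_card [RHS]big_mkcond /=; apply: eq_bigr => i _.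
by rewrite nmemE; case: (i \in B).
Qed.

Lemma height_ge B j : n <= j -> height B j = #|B|.
Proof.
rewrite -height_card => /subnKC <-; elim: (j - n) => [|m IHm].
  by rewrite addn0.
rewrite addnS heightS IHm; case jB: (nmem B _); last by rewrite addn0.
by have := nmem_lt jB; rewrite ltnNge leq_addr.
Qed.

Lemma height_le B j k : j <= k -> height B j <= height B k.
Proof.
move=> /subnK <-; elim: (k - j) => // m IHm.
by rewrite addSn heightS (leq_trans IHm) ?leq_addr.
Qed.

Lemma height_lip B j k : j <= k -> height B k <= height B j + (k - j).
Proof.
move=> jk; rewrite -{1}(subnKC jk); elim: (k - j) => [|m IHm].
  by rewrite !addn0.
by rewrite addnS heightS; case: (nmem _ _); lia.
Qed.

Lemma nmem_swap A (x y : 'I_n) j :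
  nmem (y |: (A :\ x)) j = (j == y) || (j != x) && nmem A j.
Proof.
rewrite /nmem; case: insubP => [i _ <-|jn]; first by rewrite !inE.
rewrite andbF orbF; apply/esym/negbTE; apply: contra jn => /eqP->.
exact: ltn_ord.
Qed.

Lemma height_swap A (x y : 'I_n) j : x \in A -> y \notin A ->
  height (y |: (A :\ x)) j + (x < j) = height A j + (y < j).
Proof.
move=> xA yA; elim: j => [|j IHj]; first by rewrite !heightE0.
rewrite !heightS nmem_swap.
have jx : j = x -> nmem A j by move=> ->; rewrite nmemE.
have jy : j = y -> ~~ nmem A j by move=> ->; rewrite nmemE.
have xy : x = y :> nat -> False.
  by move=> /val_inj xy; rewrite -xy xA in yA.
have [eqy|neqy] := eqVneq j y; have [eqx|neqx] := eqVneq j x; rewrite /=.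
- by case: xy; rewrite -eqx -eqy.
- by move: (jy eqy); case: (nmem A j) => // _; lia.
- by rewrite (jx eqx); lia.
- by lia.
Qed.

Lemma height_mono A B j k :
    (forall i, j <= i < k -> nmem B i -> nmem A i) -> j <= k ->
  height B k + height A j <= height A k + height B j.
Proof.
move=> sBA /subnKC jk; rewrite -jk in sBA *.
elim: (k - j) sBA => [|m IHm] sBA; first by rewrite addn0; lia.
rewrite addnS !heightS.
have ih : height B (j + m) + height A j <= height A (j + m) + height B j.
  by apply: IHm => i ij; apply: sBA; lia.
have : nmem B (j + m) -> nmem A (j + m) by apply: sBA; lia.
by case: (nmem B _); case: (nmem A _) => //= impl; first [lia | have := impl isT].
Qed.

Lemma lattice_path_height (f : nat -> nat) :
    f 0 = 0 -> (forall j, j < n -> f j <= f j.+1 <= (f j).+1) ->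
  exists B, forall j, j <= n -> height B j = f j.
Proof.
move=> f0 fS; exists [set i : 'I_n | f i < f i.+1]; elim=> [|j IHj] jn.
  by rewrite heightE0.
rewrite heightS IHj ?(ltnW jn) // -[j in nmem _ j]/(nat_of_ord (Ordinal jn)).
by rewrite nmemE inE /=; have := fS j jn; case: ltnP; lia.
Qed.

(** The bounds are arbitrary functions, not necessarily lattice paths, so that a cut can be recorded
    by changing a bound at a single position. *)
Definition lattice_sets (l u : nat -> nat) : {set {set 'I_n}} :=
  [set B | [forall j : 'I_n.+1, l j <= height B j <= u j]].

Lemma lattice_setsP (l u : nat -> nat) B :
  reflect (forall j, j <= n -> l j <= height B j <= u j)
          (B \in lattice_sets l u).
Proof.
rewrite inE; apply: (iffP forallP) => [H j jn|H j].
  by have := H (Ordinal (jn : j < n.+1)).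
by apply: H; rewrite -ltnS.
Qed.

Lemma lattice_basis_axioms (l u : nat -> nat) : l n = u n ->
  lattice_sets l u != set0 -> basis_axioms (lattice_sets l u).
Proof.
move=> lun ne0; rewrite /basis_axioms ne0 /=.
apply/forallP => A; apply/implyP => /lattice_setsP AP.
apply/forallP => B; apply/implyP => /lattice_setsP BP.
apply/forallP => x; apply/implyP; rewrite inE => /andP[xB xA].
have hn : height A n = height B n.
  by have := AP n (leqnn n); have := BP n (leqnn n); lia.
(* Swapping [x] for [y] lowers the path of [A] on (x, y] or raises it on (y, x]. It stays in the
   region when [B] lies strictly below, respectively above, [A] there. *)
suff [y [yB yA yP]] : exists y : 'I_n, [/\ y \in B, y \notin A &
    forall j, j <= n -> (x < j <= y -> height B j < height A j) /\
                        (y < j <= x -> height A j < height B j)].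
  apply/existsP; exists y; rewrite inE yA yB /=; apply/lattice_setsP => j jn.
  have := height_swap j xA yA; have := AP j jn; have := BP j jn.
  have [] := yP j jn.
  move: (height _ j) (height A j) (height B j) (l j) (u j) => h hA hB a b.
  by case: (ltnP x j); case: (ltnP y j) => /= _ _ H1 H2;
     do ?[move/(_ isT): H1 => H1]; do ?[move/(_ isT): H2 => H2]; lia.
have [AB|BA] := ltnP (height B x.+1) (height A x.+1).
  (* The first element of [B] outside [A] beyond [x]: up to it the lead of [A] over [B] cannot
     shrink. The other case is the mirror image, with the last such element before [x]. *)
  pose p y := [&& x < y, nmem B y & ~~ nmem A y].
  have exy : exists y, p y.
    case: (pselect (exists y, p y)) => // nex.
    have : height B n + height A x.+1 <= height A n + height B x.+1.
      apply: height_mono (ltn_ord x) => i /andP[xi _] iB.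
      by apply/negPn/negP => iA; apply: nex; exists i; apply/and3P.
    by lia.
  case: (ex_minnP exy) => y0 /and3P[xy y0B y0A] miny.
  have [y yB yE] := nmem_ex y0B; exists y; split; rewrite -?nmemE ?yE //.
  move=> j jn; split=> [/andP[xj jy]|]; last by lia.
  have : height B j + height A x.+1 <= height A j + height B x.+1.
    apply: height_mono xj => i /andP[xi ij] iB.
    apply/negPn/negP => iA; have /miny : p i by apply/and3P.
    by lia.
  by lia.
have hx : height A x < height B x.
  by move: BA; rewrite !heightS !nmemE xA (negbTE xB); lia.
pose p y := [&& y < x, nmem B y & ~~ nmem A y].
have exy : exists y, p y.
  case: (pselect (exists y, p y)) => // nex.
  have : height B x + height A 0 <= height A x + height B 0.
    apply: height_mono => // i /andP[_ ix] iB.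
    by apply/negPn/negP => iA; apply: nex; exists i; apply/and3P.
  by rewrite !heightE0; lia.
have ubp y : p y -> y <= x by case/and3P; lia.
case: (ex_maxnP exy ubp) => y0 /and3P[xy y0B y0A] maxy.
have [y yB yE] := nmem_ex y0B; exists y; split; rewrite -?nmemE ?yE //.
move=> j jn; split=> [|/andP[yj jx]]; first by lia.
have : height B x + height A j <= height A x + height B j.
  apply: height_mono jx => i /andP[ji ix] iB.
  apply/negPn/negP => iA; have /maxy : p i by apply/and3P.
  by lia.
by lia.
Qed.

End Heights.

(** * Integrality of the polytope given by integer bounds on prefix sums *)

Section LatticePolytope.
Local Open Scope ring_scope.
Variables (R : realType) (n : nat).
Implicit Types (x y : 'I_n -> R) (B : {set 'I_n}) (l u : nat -> nat).

Definition coord x (j : nat) : R := if insub j is Some i then x i else 0.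
Definition psum x (j : nat) : R := \sum_(i < j) coord x i.

Lemma coordE x (i : 'I_n) : coord x i = x i.
Proof. by rewrite /coord (valK i). Qed.

Lemma psum0 x : psum x 0 = 0.
Proof. by rewrite /psum big_ord0. Qed.

Lemma psumS x j : psum x j.+1 = psum x j + coord x j.
Proof. by rewrite /psum big_ord_recr. Qed.

Lemma psum_lin x j : psum x j = lin (fun i : 'I_n => (i < j)%N%:R) x.
Proof.
elim: j => [|j IHj]; first by rewrite psum0 /lin big1 // => i _; rewrite mul0r.
rewrite psumS IHj /lin /coord; case: insubP => [k kn kj|].
  rewrite (bigD1 k) //= kj ltnn mul0r add0r [RHS](bigD1 k) //= kj ltnSn mul1r addrC.
  congr (_ + _); apply: eq_bigr => i ik; rewrite ltnS [in RHS]leq_eqVlt.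
  by rewrite -kj (inj_eq val_inj) (negbTE ik).
rewrite -leqNgt addr0 => nj; apply: eq_bigr => i _.
by rewrite (leq_trans (ltn_ord i) nj) (leq_trans (ltn_ord i)) // ltnW.
Qed.

Lemma weight_prefix B j :
  weight (fun i : 'I_n => (i < j)%N%:R) B = (height B j)%:R :> R.
Proof.
rewrite -lin_vertex -psum_lin /psum /height natr_sum; apply: eq_bigr => i _.
by rewrite /coord /nmem; case: insubP.
Qed.

Definition lattice_polytope l u x :=
  (forall i, 0 <= x i <= 1) /\
  (forall j, (j <= n)%N -> (l j)%:R <= psum x j <= (u j)%:R).

Definition conv (Bs : {set {set 'I_n}}) x := exists w : {set 'I_n} -> R,
  [/\ forall B, 0 <= w B, \sum_(B in Bs) w B = 1 &
      forall i, x i = \sum_(B in Bs) w B * (i \in B)%:R].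

Lemma conv_lattice_polytope l u x :
  conv (lattice_sets n l u) x -> lattice_polytope l u x.
Proof.
move=> [w [w0 w1 wE]]; split=> [i|j jn].
  rewrite wE; apply/andP; split; first by apply: sumr_ge0 => B _; rewrite mulr_ge0.
  rewrite -[X in _ <= X]w1; apply: ler_sum => B _.
  by rewrite ler_piMr // lern1; case: (_ \in _).
rewrite psum_lin (lin_comb _ wE).
apply/andP; split.
  rewrite -[X in X <= _]mul1r -[X in X * _ <= _]w1 mulr_suml.
  apply: ler_sum => B /lattice_setsP/(_ _ jn)/andP[lB uB].
  by rewrite weight_prefix ler_wpM2l // ler_nat.
rewrite -[X in _ <= X]mul1r -[X in _ <= X * _]w1 mulr_suml.
apply: ler_sum => B /lattice_setsP/(_ _ jn)/andP[lB uB].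
by rewrite weight_prefix ler_wpM2l // ler_nat.
Qed.

Definition fractional x j := (Num.truncn (psum x j))%:R != psum x j.

Lemma fractional0 x : fractional x 0 = false.
Proof. by rewrite /fractional psum0 Num.Theory.truncn0 eqxx. Qed.

(** Read on prefix sums, this adds [t] to every non-integral one and fixes the integral ones. *)
Definition shift x (t : R) : 'I_n -> R :=
  fun i => x i + t * ((fractional x i.+1)%:R - (fractional x i)%:R).

Lemma psum_shift x t j : (j <= n)%N ->
  psum (shift x t) j = psum x j + t * (fractional x j)%:R.
Proof.
elim: j => [|j IHj] jn; first by rewrite !psum0 fractional0 mulr0 addr0.
rewrite !psumS IHj ?(ltnW jn) //.
rewrite -[j in coord _ j]/(nat_of_ord (Ordinal jn)) coordE /shift /=.
by rewrite -(coordE x) /=; ring.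
Qed.

Lemma psum_ge0 l u x j : lattice_polytope l u x -> 0 <= psum x j.
Proof.
move=> [x01 _]; elim: j => [|j IHj]; first by rewrite psum0.
rewrite psumS addr_ge0 // /coord; case: insubP => // i _ _.
by case/andP: (x01 i).
Qed.

(** No moved prefix sum leaves its unit interval, so the integer bounds survive. A coordinate with
    both ends moved or both fixed is unchanged; otherwise one end is an integer and the other stays
    in a unit interval having that integer as an end, which keeps the difference in [0, 1]. *)
Lemma lattice_polytope_shift l u x t : lattice_polytope l u x ->
    (forall j, (j <= n)%N -> fractional x j ->
      (Num.truncn (psum x j))%:R <= psum x j + t
        <= (Num.truncn (psum x j)).+1%:R) ->
  lattice_polytope l u (shift x t).
Proof.
move=> xP tP; have [x01 xlu] := xP.
have tr j := Num.Theory.truncn_itv (psum_ge0 j xP).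
split=> [i|j jn]; last first.
  rewrite psum_shift //; have := xlu j jn.
  case fj: (fractional x j); last by rewrite mulr0 addr0.
  rewrite mulr1 => /andP[lj uj]; have /andP[t1 t2] := tP j jn fj.
  have /andP[tr1 tr2] := tr j; apply/andP; split.
    by apply: le_trans t1; rewrite ler_nat Num.Theory.truncn_ge_nat ?(psum_ge0 _ xP).
  apply: le_trans t2 _; rewrite ler_nat Num.Theory.truncn_lt_nat ?(psum_ge0 _ xP) //.
  rewrite lt_neqAle uj andbT; apply: contraTneq fj => sE.
  by rewrite /fractional sE Num.Theory.natrK eqxx.
have := psumS x i; rewrite coordE; set s := psum x i; set s' := psum x i.+1 => s'E.
have /andP[xi0 xi1] := x01 i.
have := tr i; have := tr i.+1; rewrite -/s -/s'.
rewrite /shift; case fi: (fractional x i); case fS: (fractional x i.+1);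
  rewrite ?subrr ?subr0 ?sub0r ?mulr0 ?addr0 ?mulr1 ?mulrN1 => /andP[a1 a2] /andP[b1 b2].
- exact: x01.
- have := tP i (ltnW (ltn_ord i)) fi; rewrite -/s => /andP[c1 c2].
  have s'I : (Num.truncn s')%:R = s' by apply/eqP/negbFE.
  have : (Num.truncn s < Num.truncn s')%N.
    rewrite -(ltr_nat R) s'I (@lt_le_trans _ _ s) //; last by lra.
    by rewrite lt_neqAle b1 andbT.
  rewrite -(ler_nat R) s'I => d1.
  have : (Num.truncn s' <= (Num.truncn s).+1)%N.
    rewrite -ltnS -(ltr_nat R) s'I; apply: le_lt_trans (_ : s + 1 < _); first by lra.
    by rewrite -[in X in _ < X]addn1 natrD ltrD2r.
  rewrite -(ler_nat R) s'I => d2; lra.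
- have := tP i.+1 (ltn_ord i) fS; rewrite -/s' => /andP[c1 c2].
  have sI : (Num.truncn s)%:R = s by apply/eqP/negbFE.
  have : (Num.truncn s <= Num.truncn s')%N.
    by rewrite Num.Theory.truncn_ge_nat ?(psum_ge0 _ xP) // sI; lra.
  rewrite -(ler_nat R) sI => d1.
  have : (Num.truncn s' < (Num.truncn s).+1)%N.
    rewrite Num.Theory.truncn_lt_nat ?(psum_ge0 _ xP) //.
    have : s' <= (Num.truncn s).+1%:R by rewrite -addn1 natrD sI; lra.
    rewrite le_eqVlt => /orP[/eqP sE|//].
    by move: fS; rewrite /fractional -/s' sE Num.Theory.natrK eqxx.
  rewrite ltnS -(ler_nat R) sI => d2.
  move: c2; rewrite -addn1 natrD => c2; lra.
- exact: x01.
Qed.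

Definition fractionals x := [set j : 'I_n.+1 | fractional x j].

Lemma fractionals_shift x t (k : 'I_n.+1) : fractional x k ->
    psum x k + t \is a Num.nat ->
  (#|fractionals (shift x t)| < #|fractionals x|)%N.
Proof.
move=> fk kt; apply: proper_card; apply/properP; split.
  apply/subsetP => j; rewrite !inE; apply: contraTT => nfj.
  have jn : (j <= n)%N by rewrite -ltnS.
  by rewrite /fractional psum_shift // (negbTE nfj) mulr0 addr0.
have kn : (k <= n)%N by rewrite -ltnS.
exists k; rewrite !inE // /fractional (psum_shift _ _ kn) fk mulr1 negbK.
by rewrite -Num.Theory.natrEtruncn.
Qed.

(* Moving all fractional prefix sums simultaneously up or down until one of them
   becomes integral writes [x] as a convex combination of two points of the
   polytope with fewer fractional prefix sums. *)
Lemma lattice_polytope_conv l u x :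
  lattice_polytope l u x -> conv (lattice_sets n l u) x.
Proof.
have [m] := ubnP #|fractionals x|; elim: m x => // m IHm x; rewrite ltnS => lem xP.
have tr j := Num.Theory.truncn_itv (psum_ge0 j xP).
have [f0|[k0]] := set_0Vmem (fractionals x).
  have intS j : (j <= n)%N -> (Num.truncn (psum x j))%:R = psum x j.
    move=> jn; apply/eqP/negPn/negP => fj.
    have : Ordinal (jn : (j < n.+1)%N) \in fractionals x by rewrite inE.
    by rewrite f0 inE.
  have [x01 xlu] := xP.
  pose B := [set i : 'I_n | x i == 1].
  have xB i : x i = (i \in B)%:R.
    rewrite inE; have := psumS x i; rewrite coordE.
    rewrite -(intS i.+1) // -(intS i) ?(ltnW (ltn_ord i)) //.
    have /andP[xi0 xi1] := x01 i.
    set a := Num.truncn _; set b := Num.truncn _ => abE.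
    have : (b <= a)%N by rewrite -(ler_nat R); lra.
    have : (a <= b.+1)%N by rewrite -(ler_nat R) -natr1; lra.
    rewrite leq_eqVlt ltnS => /orP[/eqP aE _|ab ba].
      have -> : x i = 1 by move: abE; rewrite aE -natr1; lra.
      by rewrite eqxx.
    have aE : a = b by apply/eqP; rewrite eqn_leq ab.
    have -> : x i = 0 by move: abE; rewrite aE; lra.
    by rewrite eq_sym oner_eq0.
  have hB j : (height B j)%:R = psum x j.
    rewrite /height natr_sum; apply: eq_bigr => i _.
    by rewrite /coord /nmem; case: insubP => // k _ _; rewrite xB.
  have BP : B \in lattice_sets n l u.
    by apply/lattice_setsP => j /xlu; rewrite -hB !ler_nat.
  exists (fun A => (A == B)%:R); split=> [A||i]; first by rewrite ler0n.
    by rewrite (bigD1 B) //= eqxx big1 ?addr0 // => A /andP[_ /negbTE->].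
  rewrite (bigD1 B) //= eqxx mul1r big1 ?addr0 // => A /andP[_ /negbTE->].
  by rewrite mul0r.
rewrite inE => fk0.
pose down (j : 'I_n.+1) := psum x j - (Num.truncn (psum x j))%:R.
pose up (j : 'I_n.+1) := (Num.truncn (psum x j)).+1%:R - psum x j.
have pk0 : [pred j : 'I_n.+1 | fractional x j] k0 by [].
case: (@Order.TotalTheory.arg_minP _ _ _ k0 _ down pk0) => kd /= fkd mind.
case: (@Order.TotalTheory.arg_minP _ _ _ k0 _ up pk0) => ku /= fku minu.
have d0 : 0 < down kd.
  by rewrite subr_gt0 lt_neqAle; case/andP: (tr kd) => -> _; rewrite andbT.
have u0 : 0 < up ku by rewrite subr_gt0; case/andP: (tr ku).
have Pd : lattice_polytope l u (shift x (- down kd)).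
  apply: lattice_polytope_shift => // j jn fj.
  have := mind (Ordinal (jn : (j < n.+1)%N)) fj; rewrite {2}/down /=.
  by have /andP[] := tr j; lra.
have Pu : lattice_polytope l u (shift x (up ku)).
  apply: lattice_polytope_shift => // j jn fj.
  have := minu (Ordinal (jn : (j < n.+1)%N)) fj; rewrite {2}/up /=.
  by have /andP[] := tr j; lra.
have [|v [v0 v1 vE]] := IHm _ _ Pd.
  apply: leq_trans lem; apply: (fractionals_shift fkd).
  by rewrite /down opprB addrC subrK natr_nat.
have [|w [w0 w1 wE]] := IHm _ _ Pu.
  apply: leq_trans lem; apply: (fractionals_shift fku).
  by rewrite /up addrC subrK natr_nat.
pose k := down kd / (down kd + up ku).
have s0 : 0 < down kd + up ku by rewrite addr_gt0.
have k0' : 0 <= k by rewrite divr_ge0 // ltW.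
have k1 : k <= 1 by rewrite ler_pdivrMr // mul1r lerDl ltW.
have kE : k * (down kd + up ku) = down kd by rewrite divfK ?gt_eqF.
exists (fun B => (1 - k) * v B + k * w B); split.
- by move=> B; rewrite addr_ge0 // mulr_ge0 // subr_ge0.
- by rewrite big_split /= -!mulr_sumr v1 w1; ring.
- move=> i; transitivity ((1 - k) * shift x (- down kd) i + k * shift x (up ku) i).
    rewrite /shift; set e := _ - _%:R.
    have -> : (1 - k) * (x i + - down kd * e) + k * (x i + up ku * e) =
      x i + (k * (down kd + up ku) - down kd) * e by ring.
    by rewrite kE subrr mul0r addr0.
  rewrite vE wE !mulr_sumr -big_split /=; apply: eq_bigr => B _.
  by ring.
Qed.

(** This makes cuts harmless: bounding one prefix sum by an integer again gives a polytope of the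
    same kind. *)
Lemma base_polytope_lattice l u (M : matroid 'I_n) :
  bases M = lattice_sets n l u ->
  base_polytope M = [set x | lattice_polytope l u x]%classic.
Proof.
move=> ME; apply/seteqP; split=> x.
  by rewrite /base_polytope ME => /conv_lattice_polytope.
by move=> /lattice_polytope_conv; rewrite /base_polytope ME.
Qed.

Lemma lattice_polytope_nonempty l u x :
  lattice_polytope l u x -> lattice_sets n l u != set0.
Proof.
move=> /lattice_polytope_conv[w [_ w1 _]]; apply: contra_eq_neq w1 => ->.
by rewrite big_set0 eq_sym oner_neq0.
Qed.

End LatticePolytope.

Definition upd (f : nat -> nat) (p q j : nat) : nat := if j == p then q else f j.

Section LatticeSplit.
Local Open Scope ring_scope.
Variables (R : realType) (n : nat).

(** The hyperplane sets the prefix sum at [p] to [q]; by integrality each piece is a lattice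
    polytope with bounds changed only at [p], and [p < n] keeps the bounds equal at [n]. *)
Lemma lattice_split (g : forall T : finType, matroid T -> {poly int})
    (M : matroid 'I_n) (l u : nat -> nat) (p q : nat) (A B : {set 'I_n}) :
    is_g_polynomial R g -> bases M = lattice_sets n l u -> l n = u n ->
    (p < n)%N -> A \in bases M -> B \in bases M ->
    (height A p < q)%N -> (q < height B p)%N ->
  exists M1 M2 M12 : matroid 'I_n,
    [/\ bases M1 = lattice_sets n l (upd u p q),
        bases M2 = lattice_sets n (upd l p q) u,
        bases M12 = lattice_sets n (upd l p q) (upd u p q) &
        g _ M = g _ M1 + g _ M2 + g _ M12].
Proof.
move=> hg ME lun pn AM BM Aq qB; have np : (n == p) = false by rewrite gtn_eqF.
have pn' := ltnW pn.
pose a (i : 'I_n) : R := (i < p)%N%:R.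
have aA : weight a A < q%:R by rewrite weight_prefix ltr_nat.
have aB : q%:R < weight a B by rewrite weight_prefix ltr_nat.
have PM := base_polytope_lattice R ME.
have lq : (l p <= q)%N.
  move: (AM); rewrite ME => /lattice_setsP/(_ _ pn')/andP[lA _].
  exact: leq_trans lA (ltnW Aq).
have qu : (q <= u p)%N.
  move: (BM); rewrite ME => /lattice_setsP/(_ _ pn')/andP[_].
  exact: leq_trans (ltnW qB).
have uP (l' : nat -> nat) (x : 'I_n -> R) : lattice_polytope l' (upd u p q) x <->
    lattice_polytope l' u x /\ psum x p <= q%:R.
  rewrite /upd; split=> [[x01 xlu]|[[x01 xlu] xq]].
    have := xlu p pn'; rewrite eqxx => /andP[_ xq]; split=> //; split=> // j jn.
    have := xlu j jn; case: eqP => // -> /andP[-> _] /=.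
    by apply: le_trans xq _; rewrite ler_nat.
  split=> // j jn; have := xlu j jn; case: eqP => // -> /andP[-> _] //=.
have lP (u' : nat -> nat) (x : 'I_n -> R) : lattice_polytope (upd l p q) u' x <->
    lattice_polytope l u' x /\ q%:R <= psum x p.
  rewrite /upd; split=> [[x01 xlu]|[[x01 xlu] xq]].
    have := xlu p pn'; rewrite eqxx => /andP[xq _]; split=> //; split=> // j jn.
    have := xlu j jn; case: eqP => // -> /andP[_ ->] /=.
    by rewrite andbT; apply: le_trans xq; rewrite ler_nat.
  split=> // j jn; have := xlu j jn; case: eqP => // -> /andP[_ ->].
  by rewrite andbT.
(* A point of the cut lies in all three regions, which are therefore nonempty and define
   matroids. *)
have [x [Mx xq _]] := exists_interior_point AM BM aA aB.
have aE y : lin a y = psum y p by rewrite psum_lin.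
rewrite aE in xq; move: Mx; rewrite PM => Mx.
have x1 : lattice_polytope l (upd u p q) x by apply/uP; rewrite xq.
have x2 : lattice_polytope (upd l p q) u x by apply/lP; rewrite xq.
have x12 : lattice_polytope (upd l p q) (upd u p q) x by apply/uP; rewrite xq.
have lun1 : l n = upd u p q n by rewrite /upd np.
have lun2 : upd l p q n = u n by rewrite /upd np.
have lun12 : upd l p q n = upd u p q n by rewrite /upd np.
pose M1 := Matroid (lattice_basis_axioms lun1 (lattice_polytope_nonempty x1)).
pose M2 := Matroid (lattice_basis_axioms lun2 (lattice_polytope_nonempty x2)).
pose M12 := Matroid (lattice_basis_axioms lun12 (lattice_polytope_nonempty x12)).
exists M1, M2, M12; split=> //.
apply: (@covaluation_split R _ M M1 M2 M12 a q%:R A B) => //.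
- rewrite PM (@base_polytope_lattice _ _ _ _ M1 erefl); apply/seteqP.
  by split=> y /=; rewrite aE => /uP.
- rewrite PM (@base_polytope_lattice _ _ _ _ M2 erefl); apply/seteqP.
  by split=> y /=; rewrite aE => /lP.
- rewrite PM (@base_polytope_lattice _ _ _ _ M12 erefl); apply/seteqP.
  split=> y /=; rewrite aE.
    by move=> /uP[/lP[My ?] ?]; split=> //; apply/eqP; rewrite eq_le; apply/andP.
  by move=> [My yq]; apply/uP; rewrite yq; split=> //; apply/lP; rewrite yq.
Qed.

End LatticeSplit.

(** * Transport along bijections, and direct sums at a pinched point *)

Lemma imset_exchange (T1 T2 : finType) (f : T1 -> T2) (A : {set T1}) x y :
  injective f -> f @: (y |: (A :\ x)) = f y |: (f @: A :\ f x).
Proof.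
move=> fI; rewrite imsetU1; congr (_ |: _).
apply/setP => z; rewrite !inE; apply/imsetP/andP => [[t]|[zx /imsetP[t tA zE]]].
  rewrite !inE => /andP[tx tA] ->; rewrite (inj_eq fI); split=> //.
  exact: imset_f.
by exists t => //; rewrite !inE tA andbT -(inj_eq fI) -zE.
Qed.

Lemma bij_basis_axioms (T1 T2 : finType) (f : T1 -> T2) (Bs : {set {set T2}}) :
  bijective f -> basis_axioms Bs -> basis_axioms [set B : {set T1} | f @: B \in Bs].
Proof.
move=> fb BsP; have fI := bij_inj fb; have [f' fK f'K] := fb.
apply/andP; split.
  have [B BB] := basis_exists BsP; apply/set0Pn; exists (f' @: B).
  rewrite inE -imset_comp (eq_imset (g := id)) ?imset_id //.
apply/forallP => A; apply/implyP; rewrite inE => AB.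
apply/forallP => B; apply/implyP; rewrite inE => BB.
apply/forallP => x; apply/implyP; rewrite inE => /andP[xB xA].
have [||y [yB yA Ay]] := @basis_exchange _ _ BsP _ _ (f x) AB BB.
- exact: imset_f.
- by rewrite mem_imset.
rewrite -[y]f'K !mem_imset // in yB yA Ay.
apply/existsP; exists (f' y); rewrite !inE yA yB /=.
by rewrite imset_exchange.
Qed.

Section DirectSum.
Variables a b : nat.
Implicit Types (l u : nat -> nat).

Lemma height_lshift (B : {set 'I_(a + b)}) j : j <= a ->
  height B j = height [set i | lshift b i \in B] j.
Proof.
move=> ja; apply: eq_bigr => i _; congr (nat_of_bool _).
have ia : i < a := leq_trans (ltn_ord i) ja.
rewrite -[nat_of_ord i]/(nat_of_ord (Ordinal ia)) nmemE inE -nmemE; congr nmem.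
Qed.

Lemma height_rshift (B : {set 'I_(a + b)}) j : j <= b ->
  height B (a + j) = height B a + height [set i | rshift a i \in B] j.
Proof.
elim: j => [|j IHj] jb; first by rewrite addn0 heightE0 addn0.
rewrite addnS !heightS IHj ?(ltnW jb) // addnA; congr (_ + nat_of_bool _).
rewrite -[j in RHS]/(nat_of_ord (Ordinal jb)) nmemE inE -nmemE; congr nmem.
Qed.

(** Every path passes through the point (a, q) and splits there. Subtraction is truncated: for [u]
    the last hypothesis makes it exact, and for [l] the value 0 imposes nothing on a height. *)
Lemma lattice_sets_cat l u q (B : {set 'I_(a + b)}) :
    l a = q -> u a = q -> (forall j, j <= b -> q <= u (a + j)) ->
  (B \in lattice_sets (a + b) l u) =
  ([set i | lshift b i \in B] \in lattice_sets a l u) &&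
  ([set i | rshift a i \in B] \in
     lattice_sets b (fun j => l (a + j) - q) (fun j => u (a + j) - q)).
Proof.
move=> la ua uq; apply/lattice_setsP/andP => [BP|[/lattice_setsP B1 /lattice_setsP B2] j jn].
  have hB : height B a = q by have := BP a (leq_addr b a); rewrite la ua; lia.
  split; apply/lattice_setsP => j jn.
    by rewrite -height_lshift //; apply: BP; rewrite (leq_trans jn) ?leq_addr.
  have := BP (a + j); rewrite leq_add2l => /(_ jn).
  by rewrite height_rshift // hB; have := uq j jn; lia.
have [ja|aj] := leqP j a; first by rewrite height_lshift //; apply: B1.
have hB : height B a = q.
  by rewrite height_lshift //; have := B1 a (leqnn a); rewrite la ua; lia.
have jb : j - a <= b by rewrite leq_subLR.
rewrite -(subnKC (ltnW aj)) height_rshift // hB.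
by have := B2 _ jb; have := uq _ jb; lia.
Qed.

Lemma lattice_direct_sum (R : realType)
    (g : forall T : finType, matroid T -> {poly int}) l u q n
    (M : matroid 'I_n) (M1 : matroid 'I_a) (M2 : matroid 'I_b) :
    is_g_polynomial R g -> a + b = n -> bases M = lattice_sets n l u ->
    bases M1 = lattice_sets a l u ->
    bases M2 = lattice_sets b (fun j => l (a + j) - q) (fun j => u (a + j) - q) ->
    l a = q -> u a = q -> (forall j, j <= b -> q <= u (a + j)) ->
  g _ M = (g _ M1 * g _ M2)%R.
Proof.
move=> hg nE; case: n / nE M => M ME M1E M2E la ua uq.
have fb : bijective (@unsplit a b).
  by exists (@split a b); [apply: unsplitK | apply: splitK].
have fI := bij_inj fb.
pose N := Matroid (bij_basis_axioms fb (basesP M)).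
have <- : g _ N = g _ M.
  by apply: (g_iso hg); exists (@unsplit a b) => // B; rewrite inE.
apply: (g_direct_sum hg); rewrite /is_direct_sum /=.
have mem1 (C : {set 'I_a + 'I_b}) i : (lshift b i \in @unsplit a b @: C) = (inl i \in C).
  by rewrite -[lshift b i]/(unsplit (inl i)) mem_imset.
have mem2 (C : {set 'I_a + 'I_b}) i : (rshift a i \in @unsplit a b @: C) = (inr i \in C).
  by rewrite -[rshift a i]/(unsplit (inr i)) mem_imset.
apply/setP => C; rewrite inE ME (lattice_sets_cat _ la ua uq) -M1E -M2E.
apply/andP/imset2P => [[C1 C2]|[B1 B2 B1M B2M ->]].
  exists [set i | inl i \in C] [set i | inr i \in C].
  - by under eq_finset => i do rewrite -mem1.
  - by under eq_finset => i do rewrite -mem2.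
  - apply/setP => -[i|i]; rewrite inE.
      rewrite mem_imset; last by move=> ? ? [].
      by rewrite inE; case: imsetP => [[]|_] //; rewrite orbF.
    rewrite orbC mem_imset; last by move=> ? ? [].
    by rewrite inE; case: imsetP => [[]|_] //; rewrite orbF.
split.
  suff -> : [set i | lshift b i \in @unsplit a b @: (inl @: B1 :|: inr @: B2)] = B1 by [].
  apply/setP => i; rewrite inE mem1 inE mem_imset; last by move=> ? ? [].
  by case: imsetP => [[]|_] //; rewrite orbF.
suff -> : [set i | rshift a i \in @unsplit a b @: (inl @: B1 :|: inr @: B2)] = B2 by [].
apply/setP => i; rewrite inE mem2 inE orbC mem_imset; last by move=> ? ? [].
by case: imsetP => [[]|_] //; rewrite orbF.
Qed.

End DirectSum.

(* Between the lattice paths [l] and [u] there is exactly one unit cell at each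
   position [0 < j < n], spanning the heights [l j] and [l j + 1]. The field
   [strip_one] is only there for the degenerate case without cells. *)
Record strip (n : nat) (l u : nat -> nat) : Prop := Strip {
  strip_l0 : l 0 = 0;
  strip_u0 : u 0 = 0;
  strip_u : forall j, 0 < j < n -> u j = (l j).+1;
  strip_one : n = 1 -> l 1 <= 1;
  strip_start : 1 < n -> l 1 = 0;
  strip_step : forall j, 0 < j -> j.+1 < n -> l j <= l j.+1 <= (l j).+1;
  strip_end : 1 < n -> l n = (l n.-1).+1;
  strip_eq : l n = u n }.

Lemma strip_path n l u : strip n l u ->
  forall j, j < n -> l j <= l j.+1 <= (l j).+1.
Proof.
move=> st [|j] jn.
  rewrite (strip_l0 st); have [n1|n1] := leqP n 1.
    by apply: (strip_one st); lia.
  by rewrite (strip_start st).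
have [jn'|nj] := ltnP j.+2 n; first exact: (strip_step st).
have nE : n = j.+2 by lia.
by have := strip_end st; rewrite nE => /(_ isT) ->; rewrite leqnn leqnSn.
Qed.

Lemma strip_le n l u : strip n l u -> forall j, j <= n -> l j <= u j.
Proof.
move=> st [|j] jn; first by rewrite (strip_l0 st).
have [jn'|nj] := ltnP j.+1 n; first by rewrite (strip_u st).
by have -> : j.+1 = n by [lia]; rewrite (strip_eq st).
Qed.

Lemma lattice_sets_path n l u h : h 0 = 0 ->
    (forall j, j < n -> h j <= h j.+1 <= (h j).+1) ->
    (forall j, j <= n -> l j <= h j <= u j) ->
  exists2 B, B \in lattice_sets n l u & forall j, j <= n -> height B j = h j.
Proof.
move=> h0 hS hlu; have [B BE] := lattice_path_height h0 hS; exists B => //.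
by apply/lattice_setsP => j jn; rewrite BE //; apply: hlu.
Qed.

Lemma strip_nonempty n l u : strip n l u -> lattice_sets n l u != set0.
Proof.
move=> st; have [|B BP _] := @lattice_sets_path n l u l (strip_l0 st) (strip_path st).
  by move=> j jn; rewrite leqnn; apply: (strip_le st).
by apply/set0Pn; exists B.
Qed.

Lemma pair_circuit (T : finType) (Bs : {set {set T}}) (e f : T) :
    (forall B, B \in Bs -> e \in B -> f \in B -> False) ->
    (exists2 B, B \in Bs & e \in B) -> (exists2 B, B \in Bs & f \in B) ->
  [set e; f] \in circuits_of Bs.
Proof.
move=> efB [B1 B1B eB1] [B2 B2B fB2]; rewrite inE; apply/minsetP; split=> [|X /= Xd Xef].
  apply/negP => /existsP[B /andP[BB /subsetP sB]].
  by apply: (efB B BB); apply: sB; rewrite !inE eqxx ?orbT.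
apply/eqP; rewrite eqEsubset Xef; apply/subsetP => z.
rewrite !inE => /orP[]/eqP->; apply/negPn/negP => zX; case/negP: Xd;
  apply/existsP; [exists B2; rewrite B2B | exists B1; rewrite B1B] => /=;
  apply/subsetP => w wX; move: (subsetP Xef w wX); rewrite !inE => /orP[]/eqP wE.
- by rewrite -wE wX in zX.
- by rewrite wE.
- by rewrite wE.
- by rewrite -wE wX in zX.
Qed.

Lemma nmem_imsetP n (T : finType) (f : T -> 'I_n) (A : {set T}) j :
  reflect (exists2 t, t \in A & f t = j :> nat) (nmem (f @: A) j).
Proof.
apply: (iffP idP) => [/nmem_ex[i /imsetP[t tA ->] <-]|[t tA <-]]; first by exists t.
by rewrite nmemE imset_f.
Qed.

Section RemoveFirst.
Variables (m : nat) (T : finType) (f : T -> 'I_m.+2) (e : T).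
Hypotheses (fb : bijective f) (fe : f e = 0 :> nat).

Definition fsub (x : {x : T | x != e}) : 'I_m.+1 := inord (f (val x)).-1.

Lemma fsubE x : f (val x) = (fsub x).+1 :> nat.
Proof.
have fx0 : 0 < f (val x).
  rewrite lt0n -fe (inj_eq val_inj) (inj_eq (bij_inj fb)); exact: (valP x).
by rewrite /fsub inordK prednK // -ltnS.
Qed.

Lemma fsub_bij : bijective fsub.
Proof.
apply: inj_card_bij => [x y /(congr1 (fun i => (nat_of_ord i).+1))|].
  by rewrite -!fsubE => /val_inj/(bij_inj fb)/val_inj.
have := bij_eq_card fb; rewrite (cardD1 e) inE /= add1n !card_ord => -[<-].
by rewrite card_sig; apply/eq_leq/eq_card => x; rewrite !inE andbT.
Qed.

Lemma nmem_fsub (B : {set {x : T | x != e}}) j :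
  nmem (f @: (val @: B)) j.+1 = nmem (fsub @: B) j.
Proof.
apply/nmem_imsetP/nmem_imsetP => [[_ /imsetP[t tB ->]]|[t tB tj]].
  by rewrite fsubE => -[<-]; exists t.
by exists (val t); rewrite ?imset_f // fsubE tj.
Qed.

(** Without the first element the path begins with an east step, so heights move by one position
    only, as in a deletion; with it, as in a contraction, they also rise by one. *)
Lemma height_fsub (B : {set {x : T | x != e}}) j :
  height (f @: (val @: B)) j.+1 = height (fsub @: B) j.
Proof.
elim: j => [|j IHj]; last by rewrite [LHS]heightS IHj nmem_fsub -heightS.
rewrite heightS !heightE0; case: nmem_imsetP => // -[_ /imsetP[t _ ->]].
by rewrite fsubE.
Qed.

Lemma height_fsubU (B : {set {x : T | x != e}}) j :
  height (f @: (e |: val @: B)) j.+1 = (height (fsub @: B) j).+1.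
Proof.
elim: j => [|j IHj].
  rewrite heightS !heightE0; case: nmem_imsetP => // -[].
  by exists e => //; rewrite !inE eqxx.
rewrite [LHS]heightS IHj heightS -nmem_fsub addSn; congr (_ + nat_of_bool _).+1.
apply/nmem_imsetP/nmem_imsetP => [[t]|[t tB <-]].
  by rewrite !inE => /orP[/eqP->|tB <-]; [rewrite fe | exists t].
by exists t => //; rewrite !inE tB orbT.
Qed.

End RemoveFirst.

(** Either no path takes both of the first two elements, and these are parallel, or every path takes
    at least one, and they are in series; removing the first leaves a shorter strip. Deletion and
    contraction live on a subtype, hence the arbitrary ground set with a numbering [f]. *)
Lemma strip_series_parallel n (T : finType) (M : matroid T) (f : T -> 'I_n) l u :
    0 < n -> bijective f ->
    bases M = [set B : {set T} | f @: B \in lattice_sets n l u] ->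
    strip n l u ->
  series_parallel M.
Proof.
case: n f => // n; elim: n T M l u => [|m IHm] T M l u f _ fb ME st.
  by apply: SP_single; rewrite (bij_eq_card fb) card_ord.
have [f' fK f'K] := fb; have fI := bij_inj fb.
pose e := f' ord0; pose e' := f' (Ordinal (isT : 1 < m.+2)).
have fe : f e = 0 :> nat by rewrite /e f'K.
have fe' : f e' = 1 :> nat by rewrite /e' f'K.
have ee' : e != e' by rewrite -(inj_eq fI) -(inj_eq val_inj) /= fe fe'.
have memE (B : {set T}) t : (t \in B) = nmem (f @: B) (f t).
  by rewrite nmemE mem_imset.
have h1 (B : {set T}) : height (f @: B) 1 = (e \in B).
  by rewrite heightS heightE0 memE fe.
have h2 (B : {set T}) : height (f @: B) 2 = (e \in B) + (e' \in B).
  by rewrite heightS h1 [e' \in B]memE fe'.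
(* Bases are produced as explicit paths: a boundary path, or one with its height at position 1
   changed, supplies the required memberships of [e] and [e']. *)
have exB h : h 0 = 0 -> (forall j, j < m.+2 -> h j <= h j.+1 <= (h j).+1) ->
    (forall j, j <= m.+2 -> l j <= h j <= u j) ->
    exists2 B, B \in bases M & (e \in B) = h 1 :> nat /\ (e \in B) + (e' \in B) = h 2.
  move=> h0 hS hlu; have [C CP hC] := lattice_sets_path h0 hS hlu.
  have fC : f @: (f' @: C) = C.
    by rewrite -imset_comp (eq_imset (g := id)) ?imset_id.
  exists (f' @: C); first by rewrite ME inE fC.
  by split; [rewrite -h1 | rewrite -h2]; rewrite fC hC.
have st1 := strip_start st isT; have su1 := strip_u st (isT : 0 < 1 < m.+2).
have lpath := strip_path st; have lle := strip_le st.
have l2 : l 2 <= 1 by have := lpath 1 isT; rewrite st1; lia.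
have upd_path (h : nat -> nat) : h 0 = 0 -> h 1 <= 1 -> h 1 <= h 2 <= (h 1).+1 ->
    (forall j, 1 < j < m.+2 -> h j <= h j.+1 <= (h j).+1) ->
    forall j, j < m.+2 -> h j <= h j.+1 <= (h j).+1.
  by move=> h0 h11 h12 hS [|[|j]] jm //; [rewrite h0 | apply: hS].
have upath j : 1 < j < m.+2 -> u j <= u j.+1 <= (u j).+1.
  move=> /andP[j1 jm]; have [jm'|jm'] := ltnP j.+1 m.+2.
    have ujS : u j.+1 = (l j.+1).+1 by apply: (strip_u st).
    by rewrite ujS (strip_u st) ?jm ?andbT; have := lpath j jm; lia.
  have jE : j = m.+1 by lia.
  rewrite jE -(strip_eq st) (strip_end st) // (strip_u st) //=.
  by rewrite leqnn leqnSn.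
have [u2|u2] := leqP (u 2) 1.
  have u21 : u 2 = 1.
    move: (st) u2; case: (m) => [|k] st' u2; last first.
      by have := strip_u st' (isT : 0 < 2 < k.+3); lia.
    by rewrite -(strip_eq st') (strip_end st') //= st1.
  (* Deleting [e] keeps the paths of height 0 at position 1; that point becomes the new origin, and
     the former upper bound there is overwritten. *)
  pose l' j := if j == 0 then 0 else l j.+1.
  pose u' j := if j == 0 then 0 else u j.+1.
  have st' : strip m.+1 l' u'.
    split=> //.
    - by move=> [|j] //= jm; apply: (strip_u st).
    - move=> m1; rewrite /l' /=.
      by have := strip_u st (m1 : 0 < 2 < m.+2); rewrite u21; lia.
    - by move=> [|j] //= _ jm; apply: (strip_step st).
    - by move: (st); case: (m) => [|k] st' // _; rewrite /l' /= (strip_end st').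
    - exact: (strip_eq st).
  have ax := bij_basis_axioms (fsub_bij fb fe)
    (lattice_basis_axioms (strip_eq st') (strip_nonempty st')).
  apply: (@SP_parallel T M e e' (Matroid ax)); last first.
    exact: (IHm _ _ l' u' _ isT (fsub_bij fb fe)).
  split=> //.
  - apply: pair_circuit.
    + move=> B; rewrite ME inE => /lattice_setsP/(_ 2 isT).
      by rewrite h2 u21 => /andP[_] + eB e'B; rewrite eB e'B.
    + have [|||B BM [eB _]] := exB u.
      * exact: (strip_u0 st).
      * by apply: upd_path; rewrite ?(strip_u0 st) ?u21 ?su1 ?st1.
      * by move=> j jm; rewrite lle // leqnn.
      * by exists B => //; move: eB; rewrite su1 st1; case: (e \in B).
    + have [|||B BM [eB e'B]] := exB (upd u 1 0).
      * exact: (strip_u0 st).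
      * apply: upd_path; rewrite /upd /= ?(strip_u0 st) ?u21 //.
        by move=> [|[|j]] //= jm; apply: upath.
      * move=> j jm; rewrite /upd; case: eqP => [->|_]; first by rewrite st1.
        by rewrite lle // leqnn.
      * by exists B => //; move: e'B; rewrite eB /upd /= u21; case: (e' \in B).
  - apply/setP => B /=; rewrite [RHS]inE ME [RHS]inE [LHS]inE; symmetry.
    apply/lattice_setsP/lattice_setsP => BP [|j] jm.
    + by rewrite heightE0.
    + by rewrite -(height_fsub fb fe); apply: (BP j.+2).
    + by rewrite heightE0 (strip_l0 st).
    + rewrite (height_fsub fb fe); case: j jm => [|j] jm.
        by rewrite heightE0 st1.
      exact: (BP j.+1).
have m0 : 0 < m.
  move: (st) u2; case: (m) => // st'.
  by rewrite -(strip_eq st') (strip_end st') //= st1.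
have l21 : l 2 = 1 by have := strip_u st (m0 : 0 < 2 < m.+2); lia.
have lpos j : 1 < j -> j <= m.+2 -> 0 < l j.
  elim: j => // j IHj; rewrite ltnS leq_eqVlt => /orP[/eqP<-|j1] jm.
    by rewrite l21.
  by have := IHj j1 (ltnW jm); have := lpath j jm; lia.
have upos j : 1 < j -> j <= m.+2 -> 0 < u j.
  by move=> j1 jm; apply: leq_trans (lpos j j1 jm) (lle j jm).
(* Contracting [e] keeps the paths of height 1 at position 1; that point becomes the new origin, so
   heights drop by one. *)
pose l' j := if j == 0 then 0 else (l j.+1).-1.
pose u' j := if j == 0 then 0 else (u j.+1).-1.
have st' : strip m.+1 l' u'.
  split=> //.
  - move=> [|j] //= jm; rewrite /l' /u' /= (strip_u st) //=.
    by rewrite prednK // lpos //; lia.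
  - by move=> [m1]; rewrite m1 in m0.
  - by rewrite /l' /= l21.
  - move=> [|j] //= _ jm; rewrite /l' /=; have := lpath j.+2 (ltnW jm).
    by have := lpos j.+2 isT; lia.
  - move=> _; rewrite /l' /= (gtn_eqF m0) (strip_end st) //= prednK //.
    by apply: lpos; lia.
  - by rewrite /l' /u' /= (strip_eq st).
have ax := bij_basis_axioms (fsub_bij fb fe)
  (lattice_basis_axioms (strip_eq st') (strip_nonempty st')).
apply: (@SP_series T M e e' (Matroid ax)); last first.
  exact: (IHm _ _ l' u' _ isT (fsub_bij fb fe)).
split=> //.
- apply: pair_circuit.
  + move=> _ /imsetP[B + ->]; rewrite ME inE => /lattice_setsP/(_ 2 isT).
    by rewrite h2 l21 !inE => /andP[+ _] eB e'B; rewrite (negbTE eB) (negbTE e'B).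
  + have [|||B BM [eB _]] := exB l.
    * exact: (strip_l0 st).
    * exact: lpath.
    * by move=> j jm; rewrite lle // leqnn.
    * exists (~: B); first exact: imset_f.
      by rewrite inE; move: eB; rewrite st1; case: (e \in B).
  + have [|||B BM [eB e'B]] := exB (upd l 1 1).
    * exact: (strip_l0 st).
    * apply: upd_path; rewrite /upd /= ?(strip_l0 st) ?l21 //.
      by move=> [|[|j]] //= jm; apply: lpath.
    * move=> j jm; rewrite /upd; case: eqP => [->|_]; first by rewrite st1 su1 st1.
      by rewrite lle // leqnn.
    * exists (~: B); first exact: imset_f.
      by rewrite inE; move: e'B; rewrite eB /upd /= l21; case: (e' \in B).
- apply/setP => B /=; rewrite [RHS]inE ME [RHS]inE [LHS]inE; symmetry.
  apply/lattice_setsP/lattice_setsP => BP [|j] jm.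
  + by rewrite heightE0.
  + have := BP j.+2 jm; rewrite (height_fsubU fb fe) /l' /u' /=.
    have := lpos j.+2 isT jm; have := upos j.+2 isT jm.
    by move: (l _) (u _) (height _ _) => ? ? ?; lia.
  + by rewrite heightE0 (strip_l0 st).
  + rewrite (height_fsubU fb fe); case: j jm => [|j] jm.
      by rewrite heightE0 st1 su1 st1.
    have := BP j.+1 jm; rewrite /l' /u' /=.
    have := lpos j.+2 isT jm; have := upos j.+2 isT jm.
    by move: (l _) (u _) (height _ _) => ? ? ?; lia.
Qed.

(** * Delannoy paths and the recursion *)

Section PathSums.
Local Open Scope ring_scope.
Variables (u0 : nat -> nat) (r : nat).

(* Weighted count of the Delannoy paths of unit cells of the region below [u0],
   from the cell at position [k] and height [y] to the last cell; a diagonal step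
   weighs ['X]. *)
Fixpoint delannoy (m k y : nat) : {poly int} :=
  match m with
  | 0 => (y.+1 == r)%:R
  | m1.+1 => delannoy m1 k.+1 y +
      (if (y.+2 <= u0 k.+1)%N then
         delannoy m1 k.+1 y.+1 +
         (if m1 is m2.+1 then 'X * delannoy m2 k.+2 y.+1 else 0)
       else 0)
  end.

(** The last cell has height [r - 1], and each position raises the height by at most one. These
    zeros account for moves from which the end cannot be reached, which the recursion does not
    test. *)
Lemma delannoy_eq0 m k y : ~~ (y < r <= y.+1 + m)%N -> delannoy m k y = 0.
Proof.
have [N] := ubnP m; elim: N m k y => // N IHN [|m] k y mN yr /=.
  by case: eqP => // yE; move: yr; lia.
rewrite IHN ?add0r; [|lia|lia].
case: ifP => // _; rewrite IHN ?add0r; [|lia|lia].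
by case: m mN yr => // m mN yr; rewrite IHN ?mulr0 //; lia.
Qed.

End PathSums.

(** Translation by (a, b). Truncation does no harm, because the shifted bounds are only compared
    with positive numbers. *)
Lemma delannoy_shift (u0 u0' : nat -> nat) r r' a b m k y :
    (forall j, u0' j = u0 (a + j) - b) -> r' = r - b ->
  delannoy u0' r' m k y = delannoy u0 r m (a + k) (b + y).
Proof.
move=> uE rE; have [N] := ubnP m; elim: N m k y => // N IHN [|m] k y mN /=.
  by congr (_%:R)%R; rewrite rE; lia.
rewrite uE ltn_subRL !addnS IHN //.
case: ifP => [_|_]; last by rewrite !addnS.
rewrite IHN // !addnS; case: m mN => // m mN.
by rewrite IHN ?addnS //; lia.
Qed.

(* The lattice region consists of a strip of unit cells ending in the cell at
   position [k] and height [y], followed by all paths below [u0] from there. *)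
Record strip_state (n r : nat) (u0 : nat -> nat) (k y : nat) (l u : nat -> nat)
  : Prop := StripState {
  ss_k : 0 < k < n;
  ss_u0 : forall j, j < n -> u0 j <= u0 j.+1 <= (u0 j).+1;
  ss_n : u0 n = r;
  ss_n1 : u0 n.-1 = r;
  ss_yr : y < r;
  ss_reach : r + k <= y + n;
  ss_yu : y < u0 k;
  ss_l0 : l 0 = 0;
  ss_u0' : u 0 = 0;
  ss_l1 : l 1 = 0;
  ss_strip : forall j, 0 < j <= k -> u j = (l j).+1;
  ss_step : forall j, 0 < j < k -> l j <= l j.+1 <= (l j).+1;
  ss_lk : l k = y;
  ss_l : forall j, k < j <= n -> l j = maxn y (j + r - n);
  ss_u : forall j, k < j <= n -> u j = minn (u0 j) (y.+1 + (j - k)) }.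

Lemma path_mono n (h : nat -> nat) i j :
    (forall j, j < n -> h j <= h j.+1 <= (h j).+1) -> i <= j <= n ->
  h i <= h j <= h i + (j - i).
Proof.
move=> hS /andP[ij]; rewrite -(subnKC ij) addKn.
elim: (j - i) => [|d IHd] dn; first by rewrite !addn0 leqnn.
by rewrite addnS in dn *; have := IHd (ltnW dn); have := hS _ dn; lia.
Qed.

Section StripState.
Variables (n r : nat) (u0 : nat -> nat) (k y : nat) (l u : nat -> nat).
Hypothesis ss : strip_state n r u0 k y l u.

Lemma ss_eq : l n = u n.
Proof.
have kn := ss_k ss; rewrite (ss_l ss) ?(ss_u ss) ?leqnn ?andbT; [|lia|lia].
by rewrite (ss_n ss); have := ss_yr ss; have := ss_reach ss; lia.
Qed.

Lemma ss_lpath j : j < n -> l j <= l j.+1 <= (l j).+1.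
Proof.
move=> jn; have kn := ss_k ss; have reach := ss_reach ss.
have [->|j0] := eqVneq j 0; first by rewrite (ss_l0 ss) (ss_l1 ss).
have [jk|kj] := ltnP j k; first by apply: (ss_step ss); lia.
rewrite (ss_l ss (j := j.+1)); last by lia.
have [jk|jk] := eqVneq j k; first by rewrite jk (ss_lk ss); lia.
by rewrite (ss_l ss); lia.
Qed.

Lemma ss_upath j : j < n -> u j <= u j.+1 <= (u j).+1.
Proof.
move=> jn; have kn := ss_k ss; have yu := ss_yu ss.
have [->|j0] := eqVneq j 0.
  by rewrite (ss_u0' ss) (ss_strip ss) ?(ss_l1 ss) //; lia.
have [jk|kj] := ltnP j k.
  by rewrite !(ss_strip ss) ?ltnS; [apply: (ss_step ss)|..]; lia.
rewrite (ss_u ss (j := j.+1)); last by lia.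
have := ss_u0 ss jn.
have [jk|jk] := eqVneq j k.
  by rewrite jk (ss_strip ss) ?(ss_lk ss); lia.
by rewrite (ss_u ss); lia.
Qed.

Lemma ss_le j : j <= n -> l j <= u j.
Proof.
move=> jn; have kn := ss_k ss; have yu := ss_yu ss; have reach := ss_reach ss.
have [->|j0] := eqVneq j 0; first by rewrite (ss_l0 ss).
have [jk|kj] := leqP j k; first by rewrite (ss_strip ss); lia.
rewrite (ss_l ss) ?(ss_u ss); [|lia|lia].
have kj' : k <= j <= n by lia.
have := path_mono (ss_u0 ss) kj'.
have [jn'|jn'] := eqVneq j n; first by rewrite jn' (ss_n ss); lia.
have jn1 : j <= n.-1 <= n by lia.
have := path_mono (ss_u0 ss) jn1; rewrite (ss_n1 ss); lia.
Qed.

Lemma ss_lower : exists2 B, B \in lattice_sets n l u &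
  forall j, j <= n -> height B j = l j.
Proof.
apply: lattice_sets_path (ss_l0 ss) ss_lpath _ => j jn.
by rewrite leqnn ss_le.
Qed.

Lemma ss_upper : exists2 B, B \in lattice_sets n l u &
  forall j, j <= n -> height B j = u j.
Proof.
apply: lattice_sets_path (ss_u0' ss) ss_upath _ => j jn.
by rewrite leqnn ss_le.
Qed.

Lemma ss_axioms : basis_axioms (lattice_sets n l u).
Proof.
apply: lattice_basis_axioms ss_eq _; apply/set0Pn.
by have [B BP _] := ss_lower; exists B.
Qed.

End StripState.

Lemma eq_lattice_sets n l u l' u' :
    (forall B : {set 'I_n}, (forall j, j <= n -> l j <= height B j <= u j) <->
      (forall j, j <= n -> l' j <= height B j <= u' j)) ->
  lattice_sets n l u = lattice_sets n l' u'.
Proof.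
move=> E; apply/setP => B.
by apply/lattice_setsP/lattice_setsP => /E.
Qed.

Section StateMoves.
Variables (n r : nat) (u0 : nat -> nat) (k y : nat) (l u : nat -> nat).
Hypothesis ss : strip_state n r u0 k y l u.
Hypothesis kn : k.+1 < n.

(** No step up is possible, because of the bound or because the final height is reached; the same
    region is read with one more strip cell. *)
Lemma state_east : r + k.+1 <= y + n -> u0 k.+1 = y.+1 \/ r = y.+1 ->
  strip_state n r u0 k.+1 y l u.
Proof.
move=> reach noN; have k0 := ss_k ss; have yu := ss_yu ss.
have ku : u0 k.+1 = y.+1.
  have := ss_u0 ss (ltnW kn); case: noN => // rE.
  have kn' : k.+1 <= n <= n by lia.
  by have := path_mono (ss_u0 ss) kn'; rewrite (ss_n ss); lia.
split; try (by case: ss); try lia.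
- move=> j /andP[j0 jk]; have [jk'|jk'] := leqP j k; first by apply: (ss_strip ss); lia.
  have -> : j = k.+1 by lia.
  by rewrite (ss_l ss) ?(ss_u ss) ?ku; lia.
- by move=> j jk; apply: (ss_lpath ss); lia.
- by rewrite (ss_l ss); lia.
- by move=> j jk; apply: (ss_l ss); lia.
- move=> j jk; rewrite (ss_u ss); last by lia.
  have jk' : k.+1 <= j <= n by lia.
  by have := path_mono (ss_u0 ss) jk'; lia.
Qed.

(** The end is only just reachable, by going up at every position, so the region is already a strip
    from here on and the next cell is forced. *)
Lemma state_north : r + k = y + n -> strip_state n r u0 k.+1 y.+1 l u.
Proof.
move=> reach; have k0 := ss_k ss; have yu := ss_yu ss.
have kn1 : k.+1 <= n.-1 <= n by lia.
have := path_mono (ss_u0 ss) kn1; rewrite (ss_n1 ss) => mono.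
split; try (by case: ss); try lia.
- move=> j /andP[j0 jk]; have [jk'|jk'] := leqP j k; first by apply: (ss_strip ss); lia.
  have -> : j = k.+1 by lia.
  by rewrite (ss_l ss) ?(ss_u ss); lia.
- by move=> j jk; apply: (ss_lpath ss); lia.
- by rewrite (ss_l ss); lia.
- by move=> j jk; rewrite (ss_l ss); lia.
- by move=> j jk; rewrite (ss_u ss); lia.
Qed.

Hypothesis E : r + k.+1 <= y + n.
Hypothesis N1 : y.+1 < r.
Hypothesis N2 : y.+2 <= u0 k.+1.

Lemma state_below : exists2 u1, strip_state n r u0 k.+1 y l u1 &
  lattice_sets n l (upd u k.+1 y.+1) = lattice_sets n l u1.
Proof.
have k0 := ss_k ss; have yu := ss_yu ss.
(* A path at most [y + 1] high at [k + 1] climbs at most one per position, so the single changed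
   bound propagates to the right: [y + (j - k)] is [y + 1 + (j - (k + 1))]. *)
pose u1 j := if j <= k then u j else minn (u0 j) (y + (j - k)).
exists u1.
  split; try (by case: ss); try lia.
  - move=> j /andP[j0 jk]; rewrite /u1; case: (leqP j k) => jk'.
      by apply: (ss_strip ss); lia.
    have -> : j = k.+1 by lia.
    by rewrite (ss_l ss); lia.
  - by move=> j jk; apply: (ss_lpath ss); lia.
  - by rewrite (ss_l ss); lia.
  - by move=> j jk; apply: (ss_l ss); lia.
  - by move=> j jk; rewrite /u1; case: (leqP j k); lia.
apply: eq_lattice_sets => B; split=> BP j jn; have := BP j jn; rewrite /u1 /upd.
  case: (leqP j k) => [jk|kj]; first by case: eqP => //; lia.
  have := BP k.+1 (ltnW kn); rewrite /upd eqxx => /andP[_ hk].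
  have := height_lip B kj.
  case: eqP => [->|jk]; first by lia.
  by rewrite (ss_u ss); lia.
case: (leqP j k) => [jk|kj]; first by case: eqP => //; lia.
by case: eqP => [->|jk]; rewrite ?(ss_u ss); lia.
Qed.

Lemma state_above : exists2 l2, strip_state n r u0 k.+1 y.+1 l2 u &
  lattice_sets n (upd l k.+1 y.+1) u = lattice_sets n l2 u.
Proof.
have k0 := ss_k ss; have yu := ss_yu ss.
(* Dually, heights never decrease, which propagates the lower bound [y + 1] from [k + 1] to the
   right. *)
pose l2 j := if j <= k then l j else maxn y.+1 (j + r - n).
exists l2.
  split; try (by case: ss); try lia.
  - by rewrite /l2; case/andP: k0 => -> _; apply: (ss_l1 ss).
  - move=> j /andP[j0 jk]; rewrite /l2; case: (leqP j k) => jk'.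
      by apply: (ss_strip ss); lia.
    have -> : j = k.+1 by lia.
    by rewrite (ss_u ss); lia.
  - move=> j jk; rewrite /l2; case: (leqP j k) => jk1; case: (leqP j.+1 k) => jk2; try lia.
      by apply: (ss_lpath ss); lia.
    have -> : j = k by lia.
    by rewrite (ss_lk ss); lia.
  - by rewrite /l2 ltnn; lia.
  - by move=> j jk; rewrite /l2; case: (leqP j k); lia.
  - by move=> j jk; rewrite (ss_u ss); lia.
apply: eq_lattice_sets => B; split=> BP j jn; have := BP j jn; rewrite /l2 /upd.
  case: (leqP j k) => [jk|kj]; first by case: eqP => //; lia.
  have := BP k.+1 (ltnW kn); rewrite /upd eqxx => /andP[hk _].
  have := height_le B kj.
  case: eqP => [->|jk]; first by lia.
  by rewrite (ss_l ss); lia.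
case: (leqP j k) => [jk|kj]; first by case: eqP => //; lia.
by case: eqP => [->|jk]; rewrite ?(ss_l ss); lia.
Qed.

(** The left summand of the common facet: the strip closed off at the corner, where both bounds
    become [y + 1]. *)
Lemma state_left : strip k.+1 (upd l k.+1 y.+1) (upd u k.+1 y.+1).
Proof.
have k0 := ss_k ss; rewrite /upd; split=> //.
- by rewrite /= (ss_l0 ss).
- by rewrite /= (ss_u0' ss).
- by move=> j jk; rewrite ltn_eqF; [apply: (ss_strip ss)|]; lia.
- by move=> [kE]; rewrite kE in k0.
- by move=> k1; rewrite ltn_eqF ?(ss_l1 ss).
- by move=> j j0 jk; rewrite !ltn_eqF; [apply: (ss_step ss)|..]; lia.
- by move=> k1; rewrite eqxx /= ltn_eqF ?(ss_lk ss).
- by rewrite !eqxx.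
Qed.

(** The right summand, with the corner as new origin, starts from its own first cell, at position 1
    and height 0; the hypothesis on [u0] at [k + 1] leaves room for it. *)
Lemma state_right : exists lR uR,
  strip_state (n - k.+1) (r - y.+1) (fun j => u0 (k.+1 + j) - y.+1) 1 0 lR uR /\
  lattice_sets (n - k.+1) (fun j => upd l k.+1 y.+1 (k.+1 + j) - y.+1)
    (fun j => upd u k.+1 y.+1 (k.+1 + j) - y.+1) = lattice_sets (n - k.+1) lR uR.
Proof.
have k0 := ss_k ss; have yu := ss_yu ss.
pose lR j := if j <= 1 then 0 else j + (r - y.+1) - (n - k.+1).
pose uR j := if j <= 1 then j else minn (u0 (k.+1 + j) - y.+1) j.
exists lR, uR; split.
  split=> //; try lia.
  - move=> j jn; have jn' : k.+1 + j < n by lia.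
    by have := ss_u0 ss jn'; rewrite addnS; lia.
  - by rewrite subnKC ?(ss_n ss) // ltnW.
  - have -> : k.+1 + (n - k.+1).-1 = n.-1 by lia.
    by rewrite (ss_n1 ss).
  - by have := ss_u0 ss kn; rewrite addn1; lia.
  - by move=> j j1; have -> : j = 1 by lia.
  - by move=> j j1; rewrite /lR; case: (leqP j 1); lia.
  - by move=> j j1; rewrite /uR; case: (leqP j 1); lia.
have uk2 := ss_u0 ss kn.
have upE (f : nat -> nat) j : upd f k.+1 y.+1 (k.+1 + j.+1) = f (k.+1 + j.+1).
  by rewrite /upd; case: eqP => //; lia.
have up0 (f : nat -> nat) : upd f k.+1 y.+1 (k.+1 + 0) = y.+1.
  by rewrite /upd addn0 eqxx.
apply: eq_lattice_sets => B; split=> BP j jn; have := BP j jn;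
  have := height_lip B (leq0n j); rewrite heightE0 subn0 add0n => hj;
  rewrite /lR /uR; case: j jn hj => [|j] jn hj; rewrite ?up0 ?upE ?subnn //;
  rewrite (ss_l ss) ?(ss_u ss); try lia.
- by case: j jn hj => [|j] jn hj /=; lia.
- case: j jn hj => [|j] jn hj /=; last by lia.
  by rewrite addn1 in uk2 *; lia.
Qed.

End StateMoves.

Section GStripState.
Local Open Scope ring_scope.
Variables (R : realType) (g : forall T : finType, matroid T -> {poly int}).
Hypothesis hg : is_g_polynomial R g.

Lemma g_strip n l u (M : matroid 'I_n) : (1 < n)%N ->
  bases M = lattice_sets n l u -> strip n l u -> g M = 'X.
Proof.
move=> n1 ME st; apply: (g_series_parallel hg); first by rewrite card_ord.
apply: (@strip_series_parallel n _ M id l u) => //; first exact: ltnW.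
  by exists id.
by rewrite ME; apply/setP => B; rewrite [RHS]inE imset_id.
Qed.

(** Induction on the positions still to be crossed. A forced move leaves the matroid alone and kills
    the other terms of [delannoy]; otherwise the cut at (k+1, y+1) gives three pieces, which are the
    three terms. *)
Lemma g_strip_state n r u0 k y l u (M : matroid 'I_n) :
    strip_state n r u0 k y l u -> bases M = lattice_sets n l u ->
  g M = 'X * delannoy u0 r (n - k.+1) k y.
Proof.
have [N] := ubnP (n - k.+1)%N.
elim: N n r u0 k y l u M => // N IHN n r u0 k y l u M leN ss ME.
have /andP[k0 kn] := ss_k ss; have yr := ss_yr ss; have reach := ss_reach ss.
have [nk|kn1] := leqP n k.+1.
  have nE : n = k.+1 by lia.
  have -> : (n - k.+1 = 0)%N by lia.
  have rE : r = y.+1 by lia.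
  rewrite /= rE eqxx mulr1; apply: (g_strip _ ME); first by lia.
  split; try by case: ss.
  - by move=> j jn; apply: (ss_strip ss); lia.
  - by move=> n1; rewrite n1 in nE; lia.
  - by move=> j j0 jn; apply: (ss_lpath ss); lia.
  - by move=> _; rewrite (ss_l ss) nE /= ?(ss_lk ss); lia.
  - exact: (ss_eq ss).
have mE : (n - k.+1 = (n - k.+2).+1)%N by lia.
(* If an east move makes the end unreachable, the next move is north. *)
have [E|E] := leqP (r + k.+1) (y + n); last first.
  have rE : (r + k = y + n)%N by lia.
  have ss' := state_north ss kn1 rE.
  have yu := ss_yu ss'.
  rewrite (IHN _ _ _ _ _ _ _ _ _ ss' ME); last by lia.
  rewrite mE /= yu (@delannoy_eq0 u0 r _ _ y) ?add0r; last by lia.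
  case mE' : (n - k.+2)%N => [|m]; first by rewrite addr0.
  by rewrite (@delannoy_eq0 u0 r m) ?mulr0 ?addr0 //; lia.
have yu := ss_yu ss; have u0k := ss_u0 ss kn.
(* [N1] fails when the final height is reached, [N2] when the bound [u0] blocks a step up; either
   way the move is east. *)
have [N1|N1] := ltnP y.+1 r; last first.
  have rE : r = y.+1 by lia.
  have ss' := state_east ss kn1 E (or_intror rE).
  rewrite (IHN _ _ _ _ _ _ _ _ _ ss' ME); last by lia.
  rewrite mE /=; case: ifP => _; last by rewrite addr0.
  rewrite (@delannoy_eq0 u0 r _ _ y.+1) ?add0r; last by lia.
  case: (n - k.+2)%N => [|m]; first by rewrite addr0.
  by rewrite (@delannoy_eq0 u0 r m) ?mulr0 ?addr0 //; lia.
have [N2|N2] := ltnP y.+1 (u0 k.+1); last first.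
  have uE : u0 k.+1 = y.+1 by lia.
  have ss' := state_east ss kn1 E (or_introl uE).
  rewrite (IHN _ _ _ _ _ _ _ _ _ ss' ME); last by lia.
  by rewrite mE /= [(y.+1 < _)%N]ltnNge N2 /= addr0.
have [A AM hA] := ss_lower ss; have [B BM hB] := ss_upper ss.
rewrite -ME in AM BM.
have hAk : (height A k.+1 < y.+1)%N by rewrite hA // (ss_l ss); lia.
have hBk : (y.+1 < height B k.+1)%N by rewrite hB // (ss_u ss); lia.
have [M1 [M2 [M12 [M1E M2E M12E ->]]]] :=
  lattice_split hg ME (ss_eq ss) kn1 AM BM hAk hBk.
have [u1 ss1 E1] := state_below ss kn1 E N1 N2.
have [l2 ss2 E2] := state_above ss kn1 E N1 N2.
rewrite (IHN _ _ _ _ _ _ _ _ _ ss1); [|lia|by rewrite M1E E1].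
rewrite (IHN _ _ _ _ _ _ _ _ _ ss2); [|lia|by rewrite M2E E2].
have [lR [uR [ssR ER]]] := state_right ss kn1 E N1 N2.
have stL := state_left ss kn1 E N1 N2.
pose ML := Matroid (lattice_basis_axioms (strip_eq stL) (strip_nonempty stL)).
pose MR := Matroid (ss_axioms ssR).
have nE : (k.+1 + (n - k.+1) = n)%N by lia.
have gE : g M12 = g ML * g MR.
  apply: (lattice_direct_sum (q := y.+1) hg nE M12E) => //.
  - by rewrite /upd eqxx.
  - by rewrite /upd eqxx.
  - move=> j jn; rewrite /upd; case: eqP => [//|jk].
    rewrite (ss_u ss); last by lia.
    have jk' : (k.+1 <= k.+1 + j <= n)%N by lia.
    by have := path_mono (ss_u0 ss) jk'; lia.
(* The outer ['X] comes from the left strip and the inner one from the right state; one of them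
   remains as the weight of the diagonal step to position [k + 2] and height [y + 1]. *)
have -> : g M12 = 'X * ('X * delannoy u0 r (n - k.+3) k.+2 y.+1).
  rewrite gE (g_strip _ (erefl : bases ML = _) stL); last by lia.
  rewrite (IHN _ _ _ _ _ _ _ MR _ ssR erefl); last by lia.
  rewrite (@delannoy_shift u0 _ r _ k.+1 y.+1) // addn1 addn0.
  by congr (_ * (_ * delannoy _ _ _ _ _)); lia.
have mE2 : (n - k.+2 = (n - k.+3).+1)%N by lia.
rewrite mE /= N2 mE2; move: (delannoy _ _ _ _ _) => *; ring.
Qed.

End GStripState.

(** * Paths without diagonals, encoded as sets *)

Section PathSumSets.
Local Open Scope ring_scope.
Variables (n r : nat) (u0 : nat -> nat).
Implicit Types (A B : {set 'I_n}) (k y : nat).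

(** [A] is the part of the path already walked; strictness at the later north steps will come from
    vanishing internal activity. *)
Definition extends k A B :=
  [&& [forall i : 'I_n, (i <= k)%N ==> ((i \in B) == (i \in A))], #|B| == r &
      [forall i in B, (k < i)%N ==> (height B i < u0 i)%N]].

(** Since [nmem] is false from [n] on, the clause [i.+1 < n] keeps a final north step from counting
    as a corner. *)
Definition corners k B :=
  #|[set i in B | [&& (k < i)%N, (i.+1 < n)%N & ~~ nmem B i.+1]]|.

Lemma extendsP k A B : reflect
  [/\ forall i : 'I_n, (i <= k)%N -> (i \in B) = (i \in A), #|B| = r &
      forall i : 'I_n, i \in B -> (k < i)%N -> (height B i < u0 i)%N]
  (extends k A B).
Proof.
apply: (iffP and3P) => [[/forallP H1 /eqP H2 /forallP H3]|[H1 H2 H3]].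
  split=> // [i ik|i iB ki]; first by apply/eqP; have := H1 i; rewrite ik.
  by have := H3 i; rewrite iB ki.
split; [apply/forallP => i | exact/eqP | apply/forallP => i].
  by apply/implyP => ik; apply/eqP; apply: H1.
by apply/implyP => iB; apply/implyP; apply: H3.
Qed.

Lemma height_eq A B j : (forall i, (i < j)%N -> nmem A i = nmem B i) ->
  height A j = height B j.
Proof. by move=> AB; apply: eq_bigr => i _; rewrite AB. Qed.

Lemma nmem_eq A B i : (forall i' : 'I_n, i' = i :> nat -> (i' \in A) = (i' \in B)) ->
  nmem A i = nmem B i.
Proof. by rewrite /nmem => AB; case: insubP => // i' _ ii'; rewrite AB. Qed.

Lemma sum_extends_east k A (k1 : 'I_n) (c : {poly int}) :
    k1 = k.+1 :> nat -> (forall i : 'I_n, i \in A -> (i <= k)%N) ->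
  \sum_(B | extends k A B && (k1 \notin B)) c ^+ corners k B =
  \sum_(B | extends k.+1 A B) c ^+ corners k.+1 B.
Proof.
move=> k1E Ak.
have k1A : k1 \notin A by apply/negP => /Ak; rewrite k1E ltnn.
apply: eq_big => [B|B /andP[_ k1B]].
  apply/andP/extendsP => [[/extendsP[H1 H2 H3] k1B]|[H1 H2 H3]].
    split=> // [i|i iB ki]; last by apply: H3 => //; apply: ltnW.
    rewrite leq_eqVlt => /orP[/eqP ik|]; last by rewrite ltnS; apply: H1.
    have -> : i = k1 by apply: val_inj; rewrite /= k1E.
    by rewrite (negbTE k1A) (negbTE k1B).
  split; last by rewrite H1 ?k1E.
  apply/extendsP; split=> // [i ik|i iB ki]; first by apply: H1; apply: leqW.
  apply: H3 => //; rewrite ltn_neqAle ki andbT; apply: contraNneq k1A => ik.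
  have <- : i = k1 by apply: val_inj; rewrite /= k1E.
  by rewrite -H1 // -ik.
congr (_ ^+ _); apply: eq_card => i; rewrite !inE.
case iB: (i \in B) => //=; congr andb; rewrite [in LHS]leq_eqVlt.
case: eqP => // ik; have iE : i = k1 by apply: val_inj; rewrite /= k1E.
by rewrite -iE iB in k1B.
Qed.

Lemma corners_north k B (k1 : 'I_n) : k1 = k.+1 :> nat -> k1 \in B ->
  corners k B = (corners k.+1 B + ((k.+2 < n)%N && ~~ nmem B k.+2))%N.
Proof.
move=> k1E k1B; rewrite /corners (cardsD1 k1) inE k1B k1E ltnSn addnC.
congr (_ + _)%N; apply: eq_card => i; rewrite !inE.
case iB: (i \in B); rewrite ?andbF //= -(inj_eq val_inj) /= k1E.
by rewrite [(k.+1 < i)%N]ltn_neqAle [k.+1 == _]eq_sym andbA.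
Qed.

(** The cell (k, y) is represented by its upper right corner, hence height [y + 1] at [k + 1]. Split
    on the next step. If it is north and followed by an east step, the corner has factor ['X + 1],
    read as 1 for the two steps and ['X] for the diagonal that replaces them. *)
Lemma sum_extends m k A y : (n - k.+1 = m)%N -> (k < n)%N ->
    (forall i : 'I_n, i \in A -> (i <= k)%N) -> height A k.+1 = y.+1 ->
  \sum_(B | extends k A B) ('X + 1) ^+ corners k B = delannoy u0 r m k y.
Proof.
have [N] := ubnP m; elim: N m k A y => // N IHN m k A y mN mE kn Ak hA.
case: m mN mE => [|m] mN mE /=.
  have nE : n = k.+1 by lia.
  have cardA : #|A| = y.+1 by rewrite -height_card -hA; congr (height A _).
  have extE B : extends k A B = (B == A) && (y.+1 == r).
    apply/extendsP/andP => [[H1 H2 _]|[/eqP-> /eqP rE]].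
      have BA : B = A by apply/setP => i; apply: H1; have := ltn_ord i; lia.
      by rewrite -cardA -BA H2 !eqxx.
    split=> // [|i _ ki]; first by rewrite cardA.
    by have := ltn_ord i; lia.
  rewrite (eq_bigl _ _ extE); case: eqP => _; last first.
    by rewrite big_pred0 // => B; rewrite andbF.
  rewrite (eq_bigl (pred1 A)) => [|B]; last by rewrite andbT.
  rewrite big_pred1_eq /corners.
  rewrite (_ : #|_| = 0) ?expr0 //; apply/eqP; rewrite cards_eq0; apply/eqP/setP => i.
  by rewrite !inE; have := ltn_ord i; case: (ltnP k i); rewrite ?andbF //; lia.
have kn1 : (k.+1 < n)%N by lia.
pose k1 := Ordinal kn1.
have k1A : k1 \notin A by apply/negP => /Ak; rewrite ltnn.
have east := sum_extends_east ('X + 1) (erefl : nat_of_ord k1 = k.+1) Ak.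
rewrite (bigID (fun B => k1 \notin B)) /= east.
congr (_ + _).
  apply: IHN => //; [lia | by move=> i /Ak/leqW | rewrite heightS hA].
  by rewrite -[k.+1]/(nat_of_ord k1) nmemE (negbTE k1A) addn0.
pose A1 := k1 |: A.
have A1k i : i \in A1 -> (i <= k.+1)%N.
  by rewrite !inE => /orP[/eqP->//|/Ak/leqW].
have hA1 : height A1 k.+1 = y.+1.
  rewrite -hA; apply: height_eq => i ik; apply: nmem_eq => i' i'E.
  by rewrite !inE -(inj_eq val_inj) /= i'E (ltn_eqF ik).
have hA1' : height A1 k.+2 = y.+2.
  by rewrite heightS hA1 -[k.+1]/(nat_of_ord k1) nmemE !inE eqxx addn1.
have extN B : extends k A B && ~~ (k1 \notin B) =
    extends k.+1 A1 B && (y.+2 <= u0 k.+1)%N.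
  have hB : (forall i : 'I_n, (i <= k)%N -> (i \in B) = (i \in A)) ->
      height B k.+1 = y.+1.
    move=> H1; rewrite -hA; apply: height_eq => i ik; apply: nmem_eq => i' i'E.
    by rewrite H1 // i'E.
  rewrite negbK; apply/andP/andP => [[/extendsP[H1 H2 H3] k1B]|[/extendsP[H1 H2 H3] yu]].
    split; last by have := H3 k1 k1B (ltnSn k); rewrite /= hB.
    apply/extendsP; split=> // [i|i iB ki]; last by apply: H3 => //; apply: ltnW.
    rewrite leq_eqVlt !inE -(inj_eq val_inj) /= => /orP[/eqP ik|ik].
      have -> : i = k1 by apply: val_inj.
      by rewrite k1B eqxx.
    by rewrite (ltn_eqF ik) /=; apply: H1.
  have H1' (i : 'I_n) : (i <= k)%N -> (i \in B) = (i \in A).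
    move=> ik; rewrite H1 ?leqW // !inE -(inj_eq val_inj) /=.
    by rewrite (@ltn_eqF i k.+1).
  have k1B : k1 \in B by rewrite H1 // !inE eqxx.
  split=> //; apply/extendsP; split=> // i iB.
  rewrite leq_eqVlt => /orP[/eqP ik|]; last exact: H3.
  by rewrite -ik hB.
rewrite (eq_bigl _ _ extN); case: ifP => yu; last first.
  by rewrite big_pred0 // => B; rewrite andbF.
rewrite (eq_bigl (extends k.+1 A1)) => [|B]; last by rewrite andbT.
have k1B B : extends k.+1 A1 B -> k1 \in B.
  by move=> /extendsP[-> // _ _]; rewrite !inE eqxx.
have IH1 := IHN m k.+1 A1 y.+1 _ _ kn1 A1k hA1'.
case: m mN mE IH1 => [|m] mN mE IH1.
  rewrite addr0 -IH1 //; [|lia]; apply: eq_bigr => B /k1B k1B'.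
  by rewrite (corners_north (erefl : nat_of_ord k1 = k.+1)) // (_ : (k.+2 < n)%N = false) ?addn0 //; lia.
have kn2 : (k.+2 < n)%N by lia.
pose k2 := Ordinal kn2.
have k2A1 : k2 \notin A1 by apply/negP => /A1k; rewrite ltnn.
have east1 := sum_extends_east ('X + 1) (erefl : nat_of_ord k2 = k.+2) A1k.
have <- : \sum_(B | extends k.+2 A1 B) ('X + 1) ^+ corners k.+2 B =
    delannoy u0 r m k.+2 y.+1.
  apply: IHN => //; [lia | lia | by move=> i /A1k/leqW | rewrite heightS hA1'].
  by rewrite -[k.+2]/(nat_of_ord k2) nmemE (negbTE k2A1) addn0.
rewrite -IH1 //; last by lia.
(* The diagonal term, rewritten over the sets without [k2], is absorbed termwise: exactly these sets
   have a corner at [k1]. *)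
rewrite -east1 mulr_sumr [X in _ = _ + X]big_mkcondr -big_split /=.
apply: eq_bigr => B /k1B k1B'.
rewrite (corners_north (erefl : nat_of_ord k1 = k.+1)) // kn2 /=.
rewrite (nmemE B k2 : nmem B k.+2 = _).
by case: (k2 \notin B); rewrite ?addn0 ?addr0 // exprD expr1 mulrDr mulr1 addrC mulrC.
Qed.

End PathSumSets.

(** * Schubert matroids and activities *)

Section Gale.
Variable n : nat.
Implicit Types (U B : {set 'I_n}) (s t : seq 'I_n).

Lemma height_sum B j : height B j = \sum_(i in B) (i < j).
Proof.
elim: j => [|j IHj]; first by rewrite heightE0 big1.
rewrite heightS IHj.
have -> : \sum_(i in B) (i < j.+1) = \sum_(i in B) ((i < j) + (i == j :> nat)).
  by apply: eq_bigr => i _; rewrite ltnS; case: ltngtP.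
rewrite big_split /=; congr addn.
have [jn|nj] := ltnP j n; last first.
  rewrite big1 => [|i _]; last by rewrite ltn_eqF // (leq_trans (ltn_ord i)).
  by case nB: (nmem B j) => //; move: (nmem_lt nB); rewrite ltnNge nj.
rewrite -[j in nmem B j]/(nat_of_ord (Ordinal jn)) nmemE.
case jB: (_ \in B); last first.
  rewrite big1 // => i iB; apply/eqP; rewrite eqb0; apply: contraFneq jB => ij.
  by have <- : i = Ordinal jn by apply: val_inj.
rewrite (bigD1 (Ordinal jn)) //= eqxx big1 ?addn0 // => i /andP[_].
by rewrite -(inj_eq val_inj) /= => /negbTE->.
Qed.

Lemma height_count B j : height B j = count (fun i : 'I_n => i < j) (enum B).
Proof.
by rewrite height_sum -big_enum /= -sum1_count [RHS]big_mkcond /=; apply: eq_bigr => i _; case: ltnP.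
Qed.

Lemma sorted_enum_ord B : sorted (relpre val ltn) (enum B).
Proof.
have -> : enum B = [seq i <- enum 'I_n | i \in B] by rewrite enumT.
apply: sorted_filter; first by move=> x y z; apply: ltn_trans.
by rewrite -sorted_map val_enum_ord iota_ltn_sorted.
Qed.

(** The comparison of the heads is recovered from the threshold [b + 1]: were [b] smaller than [a],
    the first list would have no entry below it and the second at least one. *)
Lemma all2_leq_count s t :
    sorted (relpre val ltn) s -> sorted (relpre val ltn) t ->
  reflect (size s = size t /\ forall j, count (fun i : 'I_n => i < j) t <=
             count (fun i : 'I_n => i < j) s)
          (all2 (fun i j : 'I_n => i <= j) s t).
Proof.
have tr : transitive (relpre (val : 'I_n -> nat) ltn).
  by move=> x y z; apply: ltn_trans.
elim: s t => [|a s IHs] [|b t] /= ss st; try by constructor; case.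
  by constructor.
have ss' := path_sorted ss; have st' := path_sorted st.
have cnt0 (c : 'I_n) v j : path (relpre (nat_of_ord (n:=n)) ltn) c v -> j <= c ->
    count (fun i : 'I_n => i < j) v = 0.
  rewrite path_sortedE // => /andP[/allP cv _] jc; apply/eqP.
  rewrite -leqn0 leqNgt -has_count; apply/hasPn => i /cv /= ci.
  by rewrite -leqNgt (leq_trans jc) // ltnW.
apply: (iffP andP) => [[ab /IHs[//|//|sz le]]|[[sz] le]].
  split=> [|j]; first by rewrite sz.
  by apply: leq_add (le j); case: (ltnP b j) => // bj; rewrite (leq_ltn_trans ab).
have ab : a <= b.
  have := le b.+1; rewrite leqnn; case: (leqP a b) => // ba.
  have -> : (a < b.+1) = false by rewrite ltnS leqNgt ba.
  by rewrite (cnt0 a s).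
split=> //; apply/IHs => //; split=> // j.
have [jb|bj] := leqP j b; first by rewrite (cnt0 b t).
by have := le j; rewrite bj (leq_ltn_trans ab bj) leq_add2l.
Qed.

Lemma gale_leP U B :
  reflect (#|U| = #|B| /\ forall j, height B j <= height U j) (gale_le U B).
Proof.
apply: (iffP (all2_leq_count (sorted_enum_ord U) (sorted_enum_ord B))).
  by rewrite -!cardE => -[sz le]; split=> // j; rewrite !height_count.
by rewrite -!cardE => -[sz le]; split=> // j; rewrite -!height_count.
Qed.

End Gale.

Section Activities.
Variables (n : nat) (U : {set 'I_n}) (M : matroid 'I_n).
Hypothesis hM : is_schubert M U.
Implicit Types (A B : {set 'I_n}) (b x : 'I_n).

Lemma schubertP B :
  reflect (#|B| = #|U| /\ forall j, height B j <= height U j) (B \in bases M).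
Proof. by rewrite hM inE; apply: (iffP (gale_leP U B)) => -[-> ]. Qed.

Lemma card_swap B b x : b \in B -> x \notin B -> #|x |: (B :\ b)| = #|B|.
Proof.
by move=> bB xB; rewrite cardsU1 !inE (negbTE xB) andbF [in RHS](cardsD1 b) bB.
Qed.

Lemma swap_schubert B b x : B \in bases M -> b \in B -> x \notin B -> b < x ->
  x |: (B :\ b) \in bases M.
Proof.
move=> /schubertP[cB hB] bB xB bx; apply/schubertP; rewrite card_swap //.
split=> // j; have := height_swap j bB xB; have := hB j.
by move: (height _ j) (height B j) (height U j); case: (ltnP b j); case: (ltnP x j) => /=; lia.
Qed.

(** Moving an element to the right lowers the path and stays in a Schubert matroid, so any smaller
    element of [B] could be exchanged for [x]; activity forbids that there be one. *)
Lemma externally_activeE B x : B \in bases M ->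
  externally_active M B x = [forall b in B, x < b].
Proof.
move=> BM; rewrite /externally_active; case xB: (x \in B) => /=.
  by apply/esym/negbTE/forallP => /(_ x); rewrite xB ltnn.
rewrite (active_in_fund_circuit (basesP M)) ?xB //.
apply: eq_forallb => b; case bB: (b \in B) => //=.
have [xb|bx] := ltnP x b; first by rewrite implybT.
rewrite implybF; apply/negbTE; rewrite negbK swap_schubert ?xB //.
rewrite ltn_neqAle bx andbT; apply: contraFneq xB => /val_inj bx'.
by rewrite -bx'.
Qed.

Lemma internally_activeE B b : B \in bases M ->
  internally_active M B b =
  (b \in B) && [forall x, (x \notin B) ==> (x |: (B :\ b) \in bases M) ==> (b < x)].
Proof.
move=> BM; rewrite /internally_active; case bB: (b \in B) => //=.
have dP := dual_basis_axioms (basesP M).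
rewrite /cocircuits (active_in_fund_circuit dP); last 2 first.
- exact: imset_f.
- by rewrite inE bB.
apply: eq_forallb => x; rewrite inE; case xB: (x \in B) => //=.
congr (_ ==> _).
have -> : b |: (~: B :\ x) = ~: (x |: (B :\ b)).
  apply/setP => z; rewrite !inE negb_or negb_and negbK.
  have [->|_] := eqVneq z b; last by [].
  by rewrite orTb andbT; apply/esym; apply: contraTneq bB => ->; rewrite xB.
by rewrite mem_imset //; apply: setC_inj.
Qed.

(** An element [b] is inactive when a smaller [x] outside [B] can replace it. This raises the path
    on (x, b], hence needs room at [b]; conversely room at [b] suffices for the nearest such [x]. *)
Lemma int_activity_eq0 B : B \in bases M ->
  (int_activity M B == 0) = [forall b in B, height B b < height U b].
Proof.
move=> BM; have [cB hB] := schubertP _ BM.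
rewrite -[LHS]/(pred0b _); apply/pred0P/forallP => [act0 b|act b /=].
  apply/implyP => bB; have := act0 b; rewrite /= internally_activeE // bB /=.
  move/negbT; rewrite negb_forall => /existsP[x].
  rewrite !negb_imply -leqNgt => /and3P[xB /schubertP[_ hx] xb].
  have := height_swap b bB xB; have := hx b; rewrite ltnn addn0.
  have xb' : x < b.
    by rewrite ltn_neqAle xb andbT; apply: contraNneq xB => /val_inj->.
  by rewrite xb' addn1 => + <-.
rewrite internally_activeE //; apply/negbTE; rewrite negb_and.
case bB: (b \in B) => //=; have := act b; rewrite bB /= => hb.
rewrite negb_forall; apply/existsP.
(* Take the largest [x] below [b] outside [B]. Between [x] and [b] the path of [B] goes up at every
   step and that of [U] no faster, so the gap at [b] persists back to just after [x]. *)
pose p i := (i < b) && ~~ nmem B i.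
have exi : exists i, p i.
  case: (pselect (exists i, p i)) => // nex.
  have : height U b + height B 0 <= height B b + height U 0.
    apply: height_mono => // i /andP[_ ib] _.
    by apply/negPn/negP => iB; apply: nex; exists i; apply/andP.
  by rewrite !heightE0; lia.
have ubp i : p i -> i <= b by case/andP => /ltnW.
case: (ex_maxnP exi ubp) => i0 /andP[ib iB] maxi.
pose x := Ordinal (ltn_trans ib (ltn_ord b)).
have xB : x \notin B by rewrite -nmemE.
exists x; rewrite xB /= negb_imply -leqNgt (ltnW ib) andbT.
apply/schubertP; rewrite card_swap //; split=> // j.
have := height_swap j bB xB; have := hB j.
have [jb|bj] := leqP j b; have [xj|jx] := ltnP x j => /=;
  move=> hj hsw; try by move: hsw hj; move: (height _ j) (height B j); lia.
have : height U b + height B j <= height B b + height U j.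
  apply: height_mono jb => i /andP[ji ib'] _; apply/negPn/negP => iB'.
  have /maxi : p i by apply/andP.
  by rewrite leqNgt (leq_trans xj).
by move: hsw hb; move: (height _ j) (height B j); lia.
Qed.

End Activities.

Section SchubertSum.
Variables (n : nat) (U : {set 'I_n}) (M : matroid 'I_n).
Hypotheses (hM : is_schubert M U) (n1 : 1 < n) (U0 : height U 1 = 1).
Implicit Types (B : {set 'I_n}).

(** The externally active elements are those smaller than all of [B], so there is exactly one when 1
    is the minimum of [B]. *)
Lemma ext_activity_eq1 B : B \in bases M ->
  (ext_activity M B == 1) = ~~ nmem B 0 && nmem B 1.
Proof.
move=> BM; pose o0 : 'I_n := Ordinal (ltnW n1); pose o1 : 'I_n := Ordinal n1.
have -> : nmem B 0 = (o0 \in B) by exact: nmemE B o0.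
have -> : nmem B 1 = (o1 \in B) by exact: nmemE B o1.
have extE : [pred x | externally_active M B x] =i
      [pred x : 'I_n | [forall b in B, x < b]].
  by move=> x; rewrite !inE (externally_activeE hM).
rewrite /ext_activity (eq_card extE); apply/eqP/andP => [c1|[B0 B1]].
  have /card_gt0P[x] : 0 < #|[pred x : 'I_n | [forall b in B, x < b]]| by rewrite c1.
  rewrite inE => /forallP xB.
  have B0 : o0 \notin B by apply/negP => o0B; have := xB o0; rewrite o0B.
  split=> //; apply/negPn/negP => B1.
  have : 1 < #|[pred x : 'I_n | [forall b in B, x < b]]|; last by rewrite c1.
  apply/card_gt1P; exists o0, o1; split=> //; rewrite inE; apply/forallP => b;
    apply/implyP => bB /=.
  - by have := xB b; rewrite bB /=; apply: leq_ltn_trans.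
  - have b0 : b != 0 :> nat.
      by apply: contraNneq B0 => b0; have -> : o0 = b by apply: val_inj.
    have b1 : b != 1 :> nat.
      by apply: contraNneq B1 => b1; have -> : o1 = b by apply: val_inj.
    by lia.
rewrite -(card1 o0); apply: eq_card => x; rewrite !inE.
apply/forallP/eqP => [/(_ o1)|-> b]; first by rewrite B1 /= => x1; apply: val_inj => /=; lia.
apply/implyP => bB; rewrite /= lt0n; apply: contraNneq B0 => b0.
by have -> : o0 = b by apply: val_inj.
Qed.

Lemma height_le_of_lt B : (forall b : 'I_n, b \in B -> height B b < height U b) ->
  forall j, height B j <= height U j.
Proof.
move=> lt; elim=> [|j IHj]; first by rewrite !heightE0.
rewrite !heightS; case jB: (nmem B j) => /=; last by lia.
by have [b bB bE] := nmem_ex jB; have := lt b bB; rewrite bE; lia.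
Qed.

Definition singleton_one : {set 'I_n} := [set Ordinal n1].

(** The prefix [singleton_one] encodes external activity 1; strictness at position 1 is automatic,
    as the heights there are 0 and 1. *)
Lemma active_extendsE B :
  (B \in bases M) && ((ext_activity M B == 1) && (int_activity M B == 0)) =
  extends #|U| (height U) 1 singleton_one B.
Proof.
pose o0 : 'I_n := Ordinal (ltnW n1); pose o1 : 'I_n := Ordinal n1.
have B0E : nmem B 0 = (o0 \in B) by exact: nmemE B o0.
have B1E : nmem B 1 = (o1 \in B) by exact: nmemE B o1.
apply/and3P/extendsP => [[BM]|[H1 H2 H3]].
  rewrite ext_activity_eq1 // (int_activity_eq0 hM) // B0E B1E.
  move=> /andP[B0 B1] /forallP lt; split.
  - move=> i i1; rewrite inE; have [i0|i1'] := eqVneq (i : nat) 0.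
      have -> : i = o0 by apply: val_inj.
      by rewrite (negbTE B0) -(inj_eq val_inj).
    have -> : i = o1 by apply: val_inj => /=; lia.
    by rewrite B1 eqxx.
  - by have [] := schubertP hM _ BM.
  - by move=> i iB _; have := lt i; rewrite iB.
have B0 : o0 \notin B by rewrite H1 // inE -(inj_eq val_inj).
have B1 : o1 \in B by rewrite H1 // inE eqxx.
have lt b : b \in B -> height B b < height U b.
  move=> bB; have [|b1] := ltnP 1 b; first exact: H3.
  have b0 : b != 0 :> nat.
    by apply: contraNneq B0 => b0; have -> : o0 = b by apply: val_inj.
  have -> : nat_of_ord b = 1 by lia.
  by rewrite U0 heightS heightE0 B0E (negbTE B0).
have BM : B \in bases M.
  by apply/(schubertP hM); split=> //; apply: height_le_of_lt.
split=> //; first by rewrite ext_activity_eq1 // B0E B1E B0 B1.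
by rewrite (int_activity_eq0 hM) //; apply/forallP => b; apply/implyP/lt.
Qed.

(** Moving a corner step to the right lowers the path, so the result is a basis and keeps internal
    activity 0. Moving the step at 1 would destroy external activity 1, which is why corners are
    counted only beyond 1. *)
Lemma alphaE B : B \in bases M ->
    (ext_activity M B == 1) && (int_activity M B == 0) ->
  alpha M B = corners 1 B.
Proof.
move=> BM /andP[/eqP e1 /eqP i0].
have := ext_activity_eq1 BM; rewrite e1 eqxx => /esym/andP[B0 B1].
have := int_activity_eq0 hM BM; rewrite i0 eqxx => /esym/forallP ltB.
have [cB hB] := schubertP hM _ BM.
apply: eq_card => i; rewrite !inE; case iB: (i \in B) => //=.
apply/existsP/and3P => [[j /and4P[/eqP jE BM' /eqP e' _]]|[i1 iN jB]].
  have jB : j \notin B.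
    apply/negP => jB; have [cB' _] := schubertP hM _ BM'.
    have ji : j != i by rewrite -(inj_eq val_inj) /= jE gtn_eqF.
    by move: cB'; rewrite -cB cardsU1 !inE jB ji (cardsD1 i B) iB /= => /n_Sn.
  have := ext_activity_eq1 BM'; rewrite e' e1 eqxx => /esym/andP[_].
  rewrite nmem_swap jE B1 andbT => i1.
  have i0' : i != 0 :> nat.
    by apply: contraNneq B0 => i0'; rewrite -i0' nmemE.
  split; [| by rewrite -jE | by rewrite -jE nmemE].
  by move: i1 i0'; case: (nat_of_ord i) => [|[|?]].
pose j := Ordinal iN; have jB' : j \notin B by rewrite -nmemE.
exists j; rewrite eqxx /=.
have BM' : j |: (B :\ i) \in bases M by apply: (swap_schubert hM).
rewrite BM' e1 i0 /=; apply/andP; split.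
  rewrite ext_activity_eq1 // !nmem_swap (negbTE B0) B1 /= andbF andbT /=.
  by rewrite (ltn_eqF i1) orbT.
rewrite (int_activity_eq0 hM) //.
apply/forallP => b; apply/implyP; rewrite !inE => /orP[/eqP->|/andP[bi bB]] /=.
  have := height_swap i.+1 iB jB'; rewrite /= ltnSn ltnn addn0 addn1.
  rewrite [height B i.+1]heightS nmemE iB addn1 => -[->].
  have := ltB i; rewrite iB /= => lt; apply: leq_trans lt _.
  by apply: height_le.
have := height_swap b iB jB'; have := ltB b; rewrite bB /=.
have bj : b != i.+1 :> nat by apply: contraNneq jB' => bj; have -> : j = b by apply: val_inj.
have -> : (i.+1 < b) = (i < b) by rewrite [RHS]leq_eqVlt eq_sym (negbTE bj).
by move=> lt /addIn ->.
Qed.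

End SchubertSum.

Local Open Scope ring_scope.

Theorem theorem4p3 (R : realType)
    (g : forall T : finType, matroid T -> {poly int})
    (hg : is_g_polynomial R g)
    (n : nat) (hn : (0 < n)%N)
    (U : {set 'I_n}) (M : matroid 'I_n)
    (hM : is_schubert M U)
    (hloop : loopless M) (hcoloop : coloopless M) :
  g _ M = 'X * \sum_(B in bases M | (ext_activity M B == 1%N)
                                     && (int_activity M B == 0%N))
                 ('X + 1) ^+ alpha M B.
Proof.
have hUn := height_card U.
(* A basis containing the first element has height 1 at position 1, and the path of [U] is at least
   as high. *)
have U0 : height U 1 = 1%N.
  have /forallP/(_ (Ordinal hn))/existsP[B /andP[BM B0]] := hloop.
  have [_ /(_ 1%N)] := schubertP hM _ BM.
  rewrite !heightS !heightE0 (nmemE B (Ordinal hn) : nmem B 0 = _) B0.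
  by case: (nmem U 0).
have nN : (n.-1 < n)%N by rewrite prednK.
(* A basis without the last element has full height at [n - 1], and again the path of [U] is at
   least as high. *)
have Un : height U n.-1 = #|U|.
  have /forallP/(_ (Ordinal nN))/existsP[B /andP[BM Bn]] := hcoloop.
  have [cB /(_ n.-1)] := schubertP hM _ BM.
  have := height_card B; have := height_le U (leq_pred n); rewrite hUn -cB => le1 hBn.
  have : height B n.-1 = height B n.
    transitivity (height B n.-1.+1); last by congr (height B _); apply: prednK.
    by rewrite heightS (nmemE B (Ordinal nN) : nmem B n.-1 = _) (negbTE Bn) addn0.
  by move=> ->; rewrite hBn => le2; apply/eqP; rewrite eqn_leq le1.
have r0 : (0 < #|U|)%N by rewrite -hUn -U0 height_le.
have n1 : (1 < n)%N.
  rewrite ltnNge; apply/negP => nle; move: Un r0.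
  by have -> : n.-1 = 0%N by [lia]; rewrite heightE0 => <-.
have rn : (#|U| < n)%N.
  by rewrite -Un (leq_ltn_trans (height_lip U (leq0n _))) // heightE0 subn0.
have u0S j : (height U j <= height U j.+1 <= (height U j).+1)%N.
  by rewrite heightS; case: (nmem U j); lia.
pose r := #|U|.
(* The bounds that hold for any path of slope at most one are made explicit, to match the starting
   state, whose strip is the single cell at position 1 and height 0. *)
pose l j := (j + r - n)%N; pose u j := minn (height U j) j.
have ss : strip_state n r (height U) 1 0 l u.
  split=> //; rewrite /l /u /r; try lia.
  by move=> j j1; have -> : j = 1%N by [lia]; rewrite U0; lia.
have ME : bases M = lattice_sets n l u.
  apply/setP => B; apply/(schubertP hM)/lattice_setsP => [[cB hB] j jn|BP].
    have := hB j; have := height_lip B jn; have := height_lip B (leq0n j).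
    rewrite height_card cB heightE0 /l /u /r; lia.
  have cB : #|B| = #|U|.
    have := BP n (leqnn n); rewrite height_card /l /u /r hUn; lia.
  split=> // j; have [jn|/ltnW nj] := leqP j n.
    by have := BP j jn; rewrite /u; lia.
  by rewrite !height_ge // cB.
rewrite (g_strip_state hg ss ME); congr (_ * _).
rewrite -(@sum_extends n r (height U) (n - 2) 1 (singleton_one n1)) //.
- apply/esym/eq_big => B; first by rewrite (active_extendsE hM n1 U0).
  by move=> /andP[BM act]; rewrite (alphaE hM n1).
- by move=> i; rewrite inE => /eqP->.
rewrite !heightS heightE0 (nmemE _ (Ordinal n1) : nmem _ 1 = _) inE eqxx.
rewrite (nmemE _ (Ordinal hn) : nmem _ 0 = _) inE.
by rewrite -(inj_eq val_inj).
Qed.
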